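(* Let $\alpha\in[0,2)$ and let $\gamma_{\alpha,0}$ be the $2\pi$-periodic circular solution of the generalised Kepler problem with parameter $\alpha$. Then its Morse index is $$ i_{\mathrm{Morse}}(\gamma_{\alpha,0})=\begin{cases}0 & \text{if }\alpha\in[1,2),\\ 2 & \text{if }\alpha\in[0,1).\end{cases}$$
   Context: Generalised Kepler problem: fix a constant $\mu>0$ and let $U:\mathbb{R}^2\setminus\{0\}\to\mathbb{R}$ be $U(x)=\mu/|x|^{\alpha}$ if $\alpha\in(0,2)$ and $U(x)=-\mu\log|x|$ if $\alpha=0$ (the value $\alpha=0$ always denotes the logarithmic potential). The equation of motion is $\ddot x=\nabla U(x)$. The Lagrangian is $L(x,v)=\frac12|v|^2+U(x)$ and the action functional on the Sobolev loop space $W^{1,2}(\mathbb{R}/2\pi\mathbb{Z},\mathbb{R}^2\setminus\{0\})$ is $\mathbb{A}(\gamma)=\int_0^{2\pi}L(\gamma(t),\dot\gamma(t))\,dt$; its critical points are the $2\pi$-periodic classical solutions. $\gamma_{\alpha,0}$ denotes the solution describing a circle centred at the origin at constant angular speed $1$ (minimal period $2\pi$). The Morse index $i_{\mathrm{Morse}}(\gamma)$ of a critical point $\gamma$ is the maximal dimension of a subspace of $W^{1,2}(\mathbb{R}/2\pi\mathbb{Z},\mathbb{R}^2)$ on which the second variation $\mathrm{d}^2\mathbb{A}(\gamma)$ is negative definite. *)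

(* Defs.v *)
From HB Require Import structures.
From mathcomp Require Import all_boot all_order all_algebra.
From mathcomp Require Import all_classical all_reals all_analysis.

Set Implicit Arguments.
Unset Strict Implicit.
Unset Printing Implicit Defensive.

Import Order.TTheory GRing.Theory Num.Theory.
Import numFieldNormedType.Exports.

Local Open Scope ring_scope.
Local Open Scope classical_set_scope.

Section Potential.
Context {R : realType}.
Implicit Types (x v : 'rV[R]_2) (U : 'rV[R]_2 -> R).

(* The norm that the library puts on 'rV[R]_2 is the sup norm. *)
Definition enorm x : R := Num.sqrt (\sum_i x 0 i ^+ 2).

(* Only the values away from the origin are meaningful. *)
Definition kepler_potential (mu alpha : R) x : R :=
  if alpha == 0 then - mu * ln (enorm x) else mu / enorm x `^ alpha.

Definition gradient U x : 'rV[R]_2 := \row_i 'D_(delta_mx 0 i) U x.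

Definition lagrangian U x v : R := 2^-1 * enorm v ^+ 2 + U x.

Definition solves_motion U (g : R -> 'rV[R]_2) :=
  forall t, g^`(2) t = gradient U (g t).

(* omega is the signed angular velocity and theta the initial phase, so that
   the angular speed `|omega| is 1 for either orientation. *)
Definition circular_motion (g : R -> 'rV[R]_2) :=
  exists a omega theta : R, [/\ 0 < a, `|omega| = 1 &
    forall t, g t = \row_i (if i == 0 then a * cos (omega * t + theta)
                            else a * sin (omega * t + theta))].

Definition circular_solution U g := circular_motion g /\ solves_motion U g.

End Potential.

Section Sobolev.
Context {R : realType}.
Local Notation mu := (@lebesgue_measure R).
Local Notation period := (pi *+ 2 : R).
Local Notation loop := (R -> 'rV[R]_2).

(* Functions on R / 2 pi Z are 2 pi-periodic functions on R, integrated over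
   one period. *)
Definition circle : set R := `[0, period].

Definition square_integrable (g : loop) := forall i : 'I_2,
  measurable_fun circle (fun t => g t 0 i) /\
  mu.-integrable circle (fun t => (g t 0 i ^+ 2)%:E).

(* C^1 test functions define the same weak derivatives as smooth ones. *)
Definition test_function (phi : R -> R) :=
  [/\ periodic phi period, forall t, derivable phi t 1 & continuous phi^`()].

Definition weak_derivative (x g : loop) :=
  forall (i : 'I_2) (phi : R -> R), test_function phi ->
    \int[mu]_(t in circle) (x t 0 i * derive1 phi t) =
    - \int[mu]_(t in circle) (g t 0 i * phi t).

Definition L2_weak_derivative (x g : loop) :=
  square_integrable g /\ weak_derivative x g.

(* W^{1,2}(R / 2 pi Z, R^2).  In dimension one every Sobolev class has exactly
   one continuous representative, and this representative stands for it here;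
   in particular the zero class is the zero function, and a loop "with values
   in R^2 \ {0}" has its pointwise meaning. *)
Definition W12 : set loop := [set x : loop |
  [/\ periodic x period, continuous x & exists g, L2_weak_derivative x g]].

(* The weak derivative is unique up to a null set; one version is chosen. *)
Definition velocity (x : loop) : loop := xget (fun=> 0) (L2_weak_derivative x).

Definition action (U : 'rV[R]_2 -> R) (x : loop) : R :=
  \int[mu]_(t in circle) lagrangian U (x t) (velocity x t).

(* The bilinear form d^2 A(g)[xi, eta], as a mixed directional derivative. *)
Definition second_variation (U : 'rV[R]_2 -> R) (g xi eta : loop) : R :=
  derive1 (fun s => derive1 (fun t => action U (g + s *: xi + t *: eta)) 0) 0.

Definition linear_subspace (V : set loop) :=
  V 0 /\ forall (c : R) (x y : loop), V x -> V y -> V (c *: x + y).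

Definition has_dimension (V : set loop) (n : nat) :=
  exists e : 'I_n -> loop,
    [/\ forall i, V (e i),
        forall c : 'I_n -> R, \sum_i c i *: e i = 0 -> forall i, c i = 0 &
        forall x, V x -> exists c : 'I_n -> R, x = \sum_i c i *: e i].

Definition negative_definite_on (V : set loop) (B : loop -> loop -> R) :=
  forall xi, V xi -> xi <> 0 -> B xi xi < 0.

(* A supremum in the extended reals, so that the index may be infinite: an
   infinite-dimensional subspace contains subspaces of every finite
   dimension. *)
Definition morse_index (U : 'rV[R]_2 -> R) (g : loop) : \bar R :=
  ereal_sup [set (n%:R)%:E | n in [set n : nat | exists V : set loop,
    [/\ linear_subspace V, V `<=` W12, has_dimension V n &
        negative_definite_on V (second_variation U g)]]].

End Sobolev.

(* Main.v *)
Require Import Defs.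
From HB Require Import structures.
From mathcomp Require Import all_boot all_order all_algebra.
From mathcomp Require Import all_classical all_reals all_analysis.
From mathcomp Require Import measurable_realfun ring lra.

(** In the frame rotating with the circular solution (angular velocity [w],
[w ^ 2 = 1]) a variation has a radial component [u] and a tangential component
[v], and the second variation becomes the integral of
[(v' + 2 w u)^2 + u'^2 - (2 - alpha) u^2] over one period.  The square allows the
tangential component to cancel the oscillating part of [u], and it outweighs the
contribution of the mean of [u].  What remains is a Wirtinger inequality for
functions of mean zero: with constant [1] it gives index [0] when [1 <= alpha];
with a constant [2 >= 2 - alpha], which holds after two linear conditions on
[u], it gives index at most [2], and the modes [u = cos, sin] realise it when
[alpha < 1].

The Wirtinger inequalities are proved for C^1 functions and pass to W^{1,2} by
averaging over short windows: averaging does not increase the L^2 norm of the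
weak derivative.  Since the action chooses an arbitrary version of the
velocity, the expansion of the action along [gamma + r xi] rests on the
du Bois-Reymond lemma. *)

Import Order.TTheory GRing.Theory Num.Theory.
Import numFieldNormedType.Exports.

Set Implicit Arguments.
Unset Strict Implicit.
Unset Printing Implicit Defensive.

Local Open Scope ring_scope.
Local Open Scope classical_set_scope.

(** * Integrals of continuous functions *)

(** The kinetic cross term [2 w (u v' - u' v)] differs from [4 w u v'] by the derivative of a
    periodic function; this is what completes the square in [v' + 2 w u]. Mass and radius disappear:
    as a function of the squared radius the potential [Phi] satisfies
    [y Phi''(y) = - (alpha / 2 + 1) Phi'(y)], with [alpha = 0] for the logarithm, and the equation
    of motion at angular speed [1] gives [Phi'(a^2) = - 1/2].

    The Wirtinger inequalities are obtained without Fourier series, by completing a square with a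
    tangent. This reaches only constants strictly below the sharp one, so the sharp constant [1] is
    a limit case, while [2] lies strictly below the next eigenvalue [4]. The two linear conditions
    are point evaluations, which averaging preserves only approximately; they therefore enter as a
    quadratic penalty that tends to zero with the window. *)

Local Notation Int a b f := (\int[lebesgue_measure]_(t in `[a, b]) f t)%R (only parsing).

Section ContinuousIntegral.
Context {R : realType}.
Local Notation mu := (@lebesgue_measure R).
Implicit Types (a b c x : R) (f g F G : R -> R).

Lemma derive_continuous f F : (forall x, is_derive x 1 F (f x)) -> continuous F.
Proof.
by move=> dF x; apply: differentiable_continuous; apply/derivable1_diffP; case: (dF x).
Qed.

Lemma continuous_integrable f a b : continuous f ->
  mu.-integrable `[a, b] (EFin \o f).
Proof.
move=> cf; apply: continuous_compact_integrable; first exact: segment_compact.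
exact: continuous_subspaceT.
Qed.

Lemma Int_FTC F f a b : (forall x, is_derive x 1 F (f x)) -> continuous f ->
  a <= b -> Int a b f = F b - F a.
Proof.
move=> dF cf; rewrite le_eqVlt => /predU1P[->|ab].
  by rewrite set_itv1 Rintegral_set1 subrr.
have cF := derive_continuous dF.
rewrite /Rintegral (@continuous_FTC2 _ f F a b)//.
- exact: continuous_subspaceT.
- split.
  + by move=> x _; case: (dF x).
  + by apply: cvg_at_right_filter; exact: cF.
  + by apply: cvg_at_left_filter; exact: cF.
- by move=> x _; rewrite derive1E; case: (dF x).
Qed.

(** The integral from [- n] is a primitive only to the right of [- n]. Subtracting its value at [0]
    makes the choices of [n] agree, so [n] may depend on the point. *)
Lemma antiderivative f : continuous f ->
  exists F, forall x, is_derive x 1 F (f x).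
Proof.
move=> cf.
pose I n x : R := Int (- n%:R) x f.
have ci n x : mu.-integrable `[- n%:R, x] (EFin \o f) by exact: continuous_integrable.
pose F x : R := I (Num.bound `|x|) x - I (Num.bound `|x|) 0.
have IE (n m : nat) x y : (n <= m)%N -> - n%:R <= x -> - n%:R <= y ->
    I m x - I m y = I n x - I n y.
  move=> nm nx ny.
  have nmR : - m%:R <= - n%:R :> R by rewrite lerN2 ler_nat.
  have E z : - n%:R <= z -> I m z - I n z = I m (- n%:R).
    move=> nz; have : I m z - I m (- n%:R) = I n z.
      have h1 : (BLeft (- m%:R) <= BRight (- n%:R : R))%O by rewrite bnd_simp.
      have h2 : (BRight (- n%:R : R) <= BRight z)%O by rewrite bnd_simp.
      rewrite /I (Rintegral_itvB (ci m z) h1 h2).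
      by rewrite Rintegral_itv_obnd_cbnd//; apply: integrableS (ci n z) => //; exact: subset_itv_oc_cc.
    lra.
  have := E _ nx; have := E _ ny; lra.
have FE (n : nat) x : `|x| < n%:R -> F x = I n x - I n 0.
  move=> xn; rewrite /F.
  have A (k : nat) : `|x| < k%:R -> - k%:R <= x /\ - k%:R <= (0 : R).
    rewrite ltr_norml => /andP[/ltW xk _]; split; first exact: xk.
    by rewrite lerNl oppr0 ler0n.
  have x0' : `|x| < (Num.bound `|x|)%:R by exact: archi_boundP.
  have [h1 h2] := A _ xn; have [h3 h4] := A _ x0'.
  have [le|/ltnW le] := leqP (Num.bound `|x|) n.
    by rewrite (IE _ _ _ _ le).
  by rewrite (IE _ _ _ _ le).
exists F => x.
set n := Num.bound `|x|.
have xn : `|x| < n%:R by exact: archi_boundP.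
have [dI eI] : derivable (I n) x 1 /\ (I n)^`() x = f x.
  have xx1 : x < x + 1 by rewrite ltrDl.
  have nx : - n%:R < x by move: xn; rewrite ltr_norml => /andP[].
  exact: (continuous_FTC1_closed xx1 (ci n (x + 1)) nx (cf x)).
have dI' : is_derive x 1 (fun y => I n y - I n 0) (f x).
  rewrite -eI derive1E -[X in is_derive _ _ _ X]subr0.
  have := derivableP dI => ?.
  exact: is_deriveB.
apply: near_eq_is_derive dI'.
near=> y; apply/esym/FE; near: y.
apply: (cvgr_lt `|x|) => //; exact: norm_continuous.
Unshelve. all: by end_near. Qed.

Lemma is_deriveR_eq f x (d d' : R) : is_derive x 1 f d -> d = d' ->
  is_derive x 1 f d'.
Proof. by move=> ? <-. Qed.

(* Pointwise forms of library rules: the tactics derive_fun and continuous_fun below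
dispatch on the syntax of the abstraction. *)
Lemma derive_fun_cst (c x : R) : is_derive x 1 (fun=> c) (0 : R).
Proof. exact: is_derive_cst. Qed.

Lemma derive_fun_id (x : R) : is_derive x 1 (fun t : R => t) (1 : R).
Proof. exact: is_derive_id. Qed.

Lemma derive_fun_add f g x (df dg : R) : is_derive x 1 f df -> is_derive x 1 g dg ->
  is_derive x 1 (fun t => f t + g t) (df + dg).
Proof. by move=> *; exact: is_deriveD. Qed.

Lemma derive_fun_opp f x (df : R) : is_derive x 1 f df -> is_derive x 1 (fun t => - f t) (- df).
Proof. by move=> *; exact: is_deriveN. Qed.

Lemma derive_fun_mul f g x (df dg : R) : is_derive x 1 f df -> is_derive x 1 g dg ->
  is_derive x 1 (fun t => f t * g t) (df * g x + f x * dg).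
Proof.
move=> hf hg; have H := is_deriveM hf hg.
by apply: is_derive_eq H _; rewrite /GRing.scale/=; ring.
Qed.

Lemma derive_fun_exp f x (df : R) n : is_derive x 1 f df ->
  is_derive x 1 (fun t => f t ^+ n) (n%:R * f x ^+ n.-1 * df).
Proof.
move=> hf; have H := is_deriveX n hf; rewrite (_ : (fun _ => _) = f ^+ n) //.
by apply/funext => t; elim: n {H} => [|n IH]; rewrite ?expr0// !exprS IH.
Qed.

Lemma derive_fun_comp f g x (df dg : R) : is_derive (g x) 1 f df -> is_derive x 1 g dg ->
  is_derive x 1 (fun t => f (g t)) (df * dg).
Proof. by move=> *; exact: is_derive1_comp. Qed.

Lemma derive_fun_sin f x (df : R) : is_derive x 1 f df ->
  is_derive x 1 (fun t => sin (f t)) (cos (f x) * df).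
Proof. by apply: derive_fun_comp. Qed.

Lemma derive_fun_cos f x (df : R) : is_derive x 1 f df ->
  is_derive x 1 (fun t => cos (f t)) (- sin (f x) * df).
Proof. by apply: derive_fun_comp. Qed.

Lemma continuous_fun_add f g : continuous f -> continuous g -> continuous (fun t => f t + g t).
Proof. by move=> hf hg x; apply: continuousD; [exact: hf|exact: hg]. Qed.

Lemma continuous_fun_opp f : continuous f -> continuous (fun t => - f t).
Proof. by move=> hf x; apply: continuousN; exact: hf. Qed.

Lemma continuous_fun_mul f g : continuous f -> continuous g -> continuous (fun t => f t * g t).
Proof. by move=> hf hg x; apply: continuousM; [exact: hf|exact: hg]. Qed.

Lemma continuous_fun_exp f n : continuous f -> continuous (fun t => f t ^+ n).
Proof.
move=> hf; elim: n => [|n IH]; first by move=> x; exact: cvg_cst.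
by under eq_fun do rewrite exprS; exact: continuous_fun_mul.
Qed.

Lemma continuous_fun_cst c : continuous (fun _ : R => c).
Proof. by move=> x; exact: cvg_cst. Qed.

Lemma continuous_fun_comp f g : continuous f -> continuous g -> continuous (fun t => f (g t)).
Proof. by move=> hf hg x; apply: continuous_comp; [exact: hg|exact: hf]. Qed.

Lemma continuous_fun_id : continuous (fun t : R => t). Proof. by move=> x; exact: cvg_id. Qed.

End ContinuousIntegral.

(** * Syntax-directed differentiation and continuity *)

Ltac derive_fun_step := lazymatch goal with
  | |- is_derive _ _ (fun=> ?c) _ => exact: derive_fun_cst
  | |- is_derive _ _ (fun t => t) _ => exact: derive_fun_id
  | |- is_derive _ _ (fun t => @?f t + @?g t) _ => notypeclasses refine (@derive_fun_add _ f g _ _ _ _ _)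
  | |- is_derive _ _ (fun t => - @?f t) _ => notypeclasses refine (@derive_fun_opp _ f _ _ _)
  | |- is_derive _ _ (fun t => @?f t * @?g t) _ => notypeclasses refine (@derive_fun_mul _ f g _ _ _ _ _)
  | |- is_derive _ _ (fun t => @?f t ^+ ?n) _ => notypeclasses refine (@derive_fun_exp _ f _ _ n _)
  | |- is_derive _ _ (fun t => sin (@?f t)) _ => notypeclasses refine (@derive_fun_sin _ f _ _ _)
  | |- is_derive _ _ (fun t => cos (@?f t)) _ => notypeclasses refine (@derive_fun_cos _ f _ _ _)
  | H : forall x, is_derive x _ ?f _ |- is_derive _ _ (fun t => ?f t) _ => exact: H
  | H : forall x, is_derive x _ ?f _ |- is_derive _ _ ?f _ => exact: H
  | H : forall x, is_derive x _ ?f _ |- is_derive _ _ (fun t => ?f (@?g t)) _ =>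
      notypeclasses refine (@derive_fun_comp _ f g _ _ _ (H _) _)
  end.
(** The derivative is first computed into an existential variable; what remains is its equality with
    the announced one, usually left to [ring]. [notypeclasses refine] leaves the [is_derive]
    premises to the rules instead of instance search. *)
Ltac derive_fun := notypeclasses refine (@is_deriveR_eq _ _ _ _ _ _ _); [repeat derive_fun_step|cbn beta].

Ltac continuous_fun_step := lazymatch goal with
  | |- continuous (fun t => t) => exact: continuous_fun_id
  | |- continuous (fun=> ?c) => exact: continuous_fun_cst
  | |- continuous (fun t => @?f t + @?g t) => eapply (@continuous_fun_add _ f g)
  | |- continuous (fun t => - @?f t) => eapply (@continuous_fun_opp _ f)
  | |- continuous (fun t => @?f t * @?g t) => eapply (@continuous_fun_mul _ f g)
  | |- continuous (fun t => @?f t ^+ ?n) => eapply (@continuous_fun_exp _ f n)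
  | |- continuous (fun t => sin (@?f t)) => eapply (@continuous_fun_comp _ sin f); [exact: continuous_sin|]
  | |- continuous (fun t => cos (@?f t)) => eapply (@continuous_fun_comp _ cos f); [exact: continuous_cos|]
  | H : continuous ?f |- continuous (fun t => ?f t) => exact: H
  | H : continuous ?f |- continuous ?f => exact: H
  | H : continuous ?f |- continuous (fun t => ?f (@?g t)) => eapply (@continuous_fun_comp _ f g); [exact: H|]
  end.
Ltac continuous_fun := repeat continuous_fun_step.

Section ContinuousIntegralTheory.
Context {R : realType}.
Implicit Types (a b c x : R) (f g F G : R -> R).

Lemma Int_ge0 f a b : (forall x, a <= x <= b -> 0 <= f x) -> 0 <= Int a b f.
Proof. by move=> f0; apply: Rintegral_ge0 => x /=; rewrite in_itv/=; exact: f0. Qed.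

Lemma Int_le f g a b : continuous f -> continuous g ->
  (forall x, a <= x <= b -> f x <= g x) -> Int a b f <= Int a b g.
Proof.
move=> cf cg fg; apply: le_Rintegral => //.
- exact: (@continuous_integrable R f).
- exact: (@continuous_integrable R g).
Qed.

Lemma IntD f g a b : continuous f -> continuous g ->
  Int a b (fun t => f t + g t) = Int a b f + Int a b g.
Proof.
by move=> cf cg; apply: RintegralD => //; [exact: (@continuous_integrable R f)|exact: (@continuous_integrable R g)].
Qed.

Lemma IntZ c f a b : continuous f -> Int a b (fun t => c * f t) = c * Int a b f.
Proof. by move=> cf; apply: RintegralZl => //; exact: (@continuous_integrable R f). Qed.

Lemma IntN f a b : continuous f -> Int a b (fun t => - f t) = - Int a b f.
Proof.
by move=> cf; rewrite -mulN1r -IntZ//; apply: eq_Rintegral => x _; rewrite mulN1r.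
Qed.

Lemma IntC c a b : a <= b -> Int a b (fun=> c) = c * (b - a).
Proof.
move=> ab; have dF x : is_derive x 1 (fun t => c * t) c.
  by derive_fun; ring.
by rewrite (Int_FTC dF _ ab); [ring|exact: continuous_fun_cst].
Qed.

Lemma Int_split f a b c : continuous f -> a <= b -> b <= c ->
  Int a c f = Int a b f + Int b c f.
Proof.
move=> cf ab bc; have [F dF] := antiderivative cf.
by rewrite !(Int_FTC dF cf)// ?(le_trans ab)//; ring.
Qed.

Lemma Int_shift f a b c : continuous f -> a <= b ->
  Int a b (fun t => f (t + c)) = Int (a + c) (b + c) f.
Proof.
move=> cf ab; have [F dF] := antiderivative cf.
have dG x : is_derive x 1 (fun t => F (t + c)) (f (x + c)).
  by derive_fun; ring.
rewrite (Int_FTC dF cf) ?lerD2r// (Int_FTC dG)//.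
by continuous_fun.
Qed.

Lemma Int_periodic f L a : continuous f -> 0 <= L -> periodic f L ->
  Int a (a + L) f = Int 0 L f.
Proof.
move=> cf L0 pf; have [F dF] := antiderivative cf.
rewrite !(Int_FTC dF cf)// ?lerDl//.
have : F (a + L) - F a = F (0 + L) - F 0.
  apply: (@is_derive_0_is_cst _ (fun t => F (t + L) - F t)) => x.
  by derive_fun; rewrite pf; ring.
by rewrite add0r.
Qed.

End ContinuousIntegralTheory.

(** * Wirtinger inequalities *)

Section Wirtinger.
Context {R : realType}.
Implicit Types (a b c x L : R) (f g F G : R -> R).

(* The function int_a^t (f'^2 - c^2 f^2) + c tan(c (t - m)) f(t)^2, m the midpoint
of the interval, has the derivative (f' + c tan(c (t - m)) f)^2. *)
Lemma dirichlet_bound f f' a L c : (forall x, is_derive x 1 f (f' x)) ->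
  continuous f' -> 0 <= L -> 0 <= c -> c * L < pi ->
  c ^+ 2 * Int a (a + L) (fun t => f t ^+ 2) <=
  Int a (a + L) (fun t => f' t ^+ 2) +
    c * tan (c * L / 2) * (f a ^+ 2 + f (a + L) ^+ 2).
Proof.
move=> df cf' L0 c0 cL; have cf := derive_continuous df.
pose h t := f' t ^+ 2 - c ^+ 2 * f t ^+ 2.
have ch : continuous h by rewrite /h; continuous_fun.
have [P dP] := antiderivative ch.
pose s t := c * (t - (a + L / 2)).
pose G t := P t + c * tan (s t) * f t ^+ 2.
have pi0 : 0 < pi :> R := pi_gt0 R.
(* Since [c * L < pi], the phase [s] stays strictly between [- pi / 2] and [pi / 2] on the interval,
   away from the poles of the tangent. *)
have sb t : a <= t <= a + L -> 0 < cos (s t).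
  move=> /andP[at_ tL]; apply: cos_gt0_pihalf.
  have h1 : c * (t - a) <= c * L by rewrite ler_wpM2l//; lra.
  have h2 : 0 <= c * (t - a) by rewrite mulr_ge0//; lra.
  have -> : s t = c * (t - a) - c * L / 2 by rewrite /s; ring.
  by apply/andP; split; lra.
have dG t : a <= t <= a + L -> is_derive t 1 G ((f' t + c * tan (s t) * f t) ^+ 2).
  move=> tab; have c1 := sb _ tab.
  have dtan : is_derive t 1 (fun u => tan (s u)) ((cos (s t)) ^- 2 * c).
    apply: (@derive_fun_comp R tan s).
      by apply: is_derive_tan; rewrite gt_eqF.
    by rewrite /s; derive_fun; ring.
  rewrite /G.
  have dG := derive_fun_add (dP t) (derive_fun_mul (derive_fun_mul (derive_fun_cst c t) dtan) (derive_fun_exp 2 (df t))).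
  apply: is_deriveR_eq dG _; cbn beta.
  have -> : (cos (s t)) ^- 2 = 1 + tan (s t) ^+ 2.
    by rewrite cos2_tan2 ?gt_eqF// invrK.
  by rewrite /h; ring.
have aL : a <= a + L by lra.
(* [G] is differentiable only where the tangent is finite, so [Int_FTC], which asks for a derivative
   on the whole line, is replaced by the mean value theorem. *)
have [z zI GE] : exists2 z, z \in `[a, a + L]%R & G (a + L) - G a = ((f' z + c * tan (s z) * f z) ^+ 2) * (a + L - a).
  apply: (@MVT_segment R G (fun z => (f' z + c * tan (s z) * f z) ^+ 2)).
  - exact: aL.
  - by move=> x; rewrite in_itv/= => /andP[h1 h2]; apply: dG; rewrite !ltW.
  - apply: derivable_within_continuous => x; rewrite in_itv/= => xI.
    by have [] := dG x xI.
have {}GE : 0 <= G (a + L) - G a.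
  by rewrite GE mulr_ge0// ?sqr_ge0//; lra.
move: GE; rewrite /G.
have -> : s (a + L) = c * L / 2 by rewrite /s; field.
have -> : s a = - (c * L / 2) by rewrite /s; field.
rewrite tanN.
have := Int_FTC dP ch aL; rewrite /h IntD; [|continuous_fun..].
rewrite IntN; last by continuous_fun.
rewrite IntZ; last by continuous_fun.
lra.
Qed.

Lemma zero_bound f f' s L c : (forall x, is_derive x 1 f (f' x)) ->
  continuous f' -> 0 <= L -> 0 <= c -> c * L < pi -> f s = 0 -> f (s + L) = 0 ->
  c ^+ 2 * Int s (s + L) (fun t => f t ^+ 2) <= Int s (s + L) (fun t => f' t ^+ 2).
Proof.
move=> df cf' L0 c0 cL f0 fL.
have := dirichlet_bound s df cf' L0 c0 cL.
by rewrite f0 fL expr0n/= addr0 mulr0 addr0.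
Qed.

(** A sign change gives a zero [s], and [s + L] is then a zero too. The squares are [L]-periodic, so
    the Dirichlet bound on [[s, s + L]] is the bound on [[0, L]]. *)
Lemma antiperiodic_bound f f' L c : (forall x, is_derive x 1 f (f' x)) ->
  continuous f' -> 0 <= L -> 0 <= c -> c * L < pi ->
  (forall t, f (t + L) = - f t) -> (forall t, f' (t + L) = - f' t) ->
  c ^+ 2 * Int 0 L (fun t => f t ^+ 2) <= Int 0 L (fun t => f' t ^+ 2).
Proof.
move=> df cf' L0 c0 cL pf pf'; have cf := derive_continuous df.
have [s _ fs] : exists2 s, s \in `[0, L]%R & f s = 0.
  apply: IVT => //; first exact: continuous_subspaceT.
  have := pf 0; rewrite add0r => ->.
  by have [h|h] := leP 0 (f 0); rewrite ?ge_min ?le_max; apply/andP; split; apply/orP; lra.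
have fsL : f (s + L) = 0 by rewrite pf fs oppr0.
have := zero_bound df cf' L0 c0 cL fs fsL.
rewrite (@Int_periodic _ (fun t => f t ^+ 2))//; [|continuous_fun|by move=> t; rewrite pf sqrrN].
by rewrite (@Int_periodic _ (fun t => f' t ^+ 2))//; [continuous_fun|move=> t; rewrite pf' sqrrN].
Qed.

Lemma zero_mean_has_zero f L : continuous f -> 0 < L -> Int 0 L f = 0 ->
  exists s, f s = 0.
Proof.
move=> cf L0; have [F dF] := antiderivative cf.
rewrite (Int_FTC dF cf (ltW L0)) => F0.
have [s sI E] := MVT_segment (ltW L0) (fun x _ => dF x)
  (continuous_subspaceT (derive_continuous dF)).
exists s; move: E; rewrite F0 subr0 => /esym/eqP.
by rewrite mulf_eq0 (gt_eqF L0) orbF => /eqP.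
Qed.

Lemma zero_mean_bound f f' L c : (forall x, is_derive x 1 f (f' x)) ->
  continuous f' -> 0 < L -> 0 <= c -> c * L < pi ->
  periodic f L -> periodic f' L -> Int 0 L f = 0 ->
  c ^+ 2 * Int 0 L (fun t => f t ^+ 2) <= Int 0 L (fun t => f' t ^+ 2).
Proof.
move=> df cf' L0 c0 cL pf pf' /(zero_mean_has_zero (derive_continuous df) L0)[s fs].
have cf := derive_continuous df.
have fsL : f (s + L) = 0 by rewrite pf fs.
have := zero_bound df cf' (ltW L0) c0 cL fs fsL.
rewrite (@Int_periodic _ (fun t => f t ^+ 2)) ?(ltW L0)//; [|continuous_fun|by move=> t; rewrite pf].
by rewrite (@Int_periodic _ (fun t => f' t ^+ 2)) ?(ltW L0)//; [continuous_fun|move=> t; rewrite pf'].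
Qed.

(** Even and odd refer to the shift by [L], that is, to even and odd harmonics of a [2 L]-periodic
    function. A zero inside one period yields only half of the sharp constant of that period;
    treating the two parts separately on length [L] recovers every constant below the sharp value
    [pi / L]. *)
Definition even_part f L t := (f t + f (t + L)) / 2.
Definition odd_part f L t := (f t - f (t + L)) / 2.

Lemma Int_parts f L : continuous f -> 0 <= L ->
  Int 0 (2 * L) (fun t => f t ^+ 2) =
  2 * Int 0 L (fun t => even_part f L t ^+ 2) + 2 * Int 0 L (fun t => odd_part f L t ^+ 2).
Proof.
move=> cf L0; rewrite /even_part /odd_part.
rewrite -!IntZ -?IntD; [|continuous_fun..].
rewrite (@Int_split _ _ 0 L (2 * L)); [|continuous_fun|lra..].
have -> : Int L (2 * L) (fun t => f t ^+ 2) = Int 0 L (fun t => f (t + L) ^+ 2).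
  rewrite (@Int_shift _ (fun t => f t ^+ 2)); [|continuous_fun|lra].
  by rewrite add0r mulr2n mulrDl mul1r.
rewrite -IntD; [|continuous_fun..].
by apply: eq_Rintegral => t _; field.
Qed.

Section Parts.
Variables (f f' : R -> R) (L : R).
Hypothesis df : forall x, is_derive x 1 f (f' x).
Hypothesis cf' : continuous f'.
Hypothesis pf : periodic f (2 * L).
Hypothesis L0 : 0 <= L.

Let cf := derive_continuous df.

Lemma derive_periodic T : periodic f T -> periodic f' T.
Proof.
move=> pfT x; have : is_derive x 1 (fun t => f (t + T)) (f' (x + T)) by derive_fun; ring.
have -> : (fun t => f (t + T)) = f by apply/funext.
by move=> [_ <-]; case: (df x) => _ <-.
Qed.

Lemma even_part_derive x : is_derive x 1 (even_part f L) (even_part f' L x).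
Proof. by rewrite /even_part; derive_fun; ring. Qed.

Lemma odd_part_derive x : is_derive x 1 (odd_part f L) (odd_part f' L x).
Proof. by rewrite /odd_part; derive_fun; ring. Qed.

Lemma even_part_periodic g : periodic g (2 * L) -> periodic (even_part g L) L.
Proof.
move=> pg x; rewrite /even_part.
by rewrite (_ : x + L + L = x + 2 * L) ?pg 1?addrC//; ring.
Qed.

Lemma odd_part_antiperiodic g : periodic g (2 * L) ->
  forall t, odd_part g L (t + L) = - odd_part g L t.
Proof.
move=> pg x; rewrite /odd_part.
by rewrite (_ : x + L + L = x + 2 * L) ?pg; ring.
Qed.

Lemma even_part_continuous g : continuous g -> continuous (even_part g L).
Proof. by move=> cg; rewrite /even_part; continuous_fun. Qed.

Lemma odd_part_continuous g : continuous g -> continuous (odd_part g L).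
Proof. by move=> cg; rewrite /odd_part; continuous_fun. Qed.

Lemma Int_even_part : Int 0 (2 * L) f = 2 * Int 0 L (even_part f L).
Proof.
have l0 := L0; rewrite /even_part -IntZ; last by continuous_fun.
rewrite (@Int_split _ _ 0 L (2 * L)); [|continuous_fun|lra..].
have -> : Int L (2 * L) f = Int 0 L (fun t => f (t + L)).
  rewrite (@Int_shift _ f); [|continuous_fun|lra].
  by rewrite add0r mulr2n mulrDl mul1r.
rewrite -IntD; [|continuous_fun..].
by apply: eq_Rintegral => t _; field.
Qed.

Lemma wirtinger c : 0 < L -> 0 <= c -> c * L < pi -> Int 0 (2 * L) f = 0 ->
  c ^+ 2 * Int 0 (2 * L) (fun t => f t ^+ 2) <= Int 0 (2 * L) (fun t => f' t ^+ 2).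
Proof.
move=> L1 c0 cL f0; rewrite !Int_parts//.
have pf' := derive_periodic pf.
have E0 : Int 0 L (even_part f L) = 0.
  by move: f0; rewrite Int_even_part; lra.
have h1 := zero_mean_bound even_part_derive (even_part_continuous cf') L1 c0 cL
  (even_part_periodic pf) (even_part_periodic pf') E0.
have h2 := antiperiodic_bound odd_part_derive (odd_part_continuous cf') L0 c0 cL
  (odd_part_antiperiodic pf) (odd_part_antiperiodic pf').
lra.
Qed.
End Parts.

(** Here [wirtinger] with [L = pi] admits only constants below [1], so the sharp case is reached by
    contradiction. *)
Lemma wirtinger_circle f f' : (forall x, is_derive x 1 f (f' x)) -> continuous f' ->
  periodic f (2 * pi) -> Int 0 (2 * pi) f = 0 ->
  Int 0 (2 * pi) (fun t => f t ^+ 2) <= Int 0 (2 * pi) (fun t => f' t ^+ 2).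
Proof.
move=> df cf' pf f0; have pi0 : 0 < pi :> R := pi_gt0 R.
set A := Int 0 (2 * pi) (fun t => f t ^+ 2).
set B := Int 0 (2 * pi) (fun t => f' t ^+ 2).
have A0 : 0 <= A by apply: Int_ge0 => x _; exact: sqr_ge0.
rewrite leNgt; apply/negP => BA.
have B0 : 0 <= B by apply: Int_ge0 => x _; exact: sqr_ge0.
(* This is the squared constant: it is below [1], yet [c * A] is the midpoint of [A] and [B] and so
   exceeds [B]. *)
pose c := (A + B) / (2 * A).
have Ap : 0 < A by lra.
have cA : c * A = (A + B) / 2 by rewrite /c; field; rewrite gt_eqF.
have c0 : 0 <= c by rewrite /c divr_ge0//; lra.
have c1 : c < 1 by rewrite /c ltr_pdivrMr; lra.
have := @wirtinger f f' pi df cf' pf (ltW pi0) (Num.sqrt c).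
rewrite -/A -/B sqr_sqrtr// sqrtr_ge0 cA => /(_ pi0 isT).
have h : Num.sqrt c < 1 by rewrite -[ltRHS]sqrtr1 ltr_sqrt.
have h' : Num.sqrt c * pi < pi by rewrite gtr_pMl.
by move=> /(_ h' f0); lra.
Qed.

(* The two conditions f(0) = f(pi) and f(pi/2) = f(3pi/2) stand in for orthogonality
to cos and sin: they make the odd part vanish at the multiples of pi/2. *)
Lemma wirtinger_constrained : exists2 K : R, 0 <= K &
  forall f f', (forall x, is_derive x 1 f (f' x)) -> continuous f' ->
  periodic f (2 * pi) -> Int 0 (2 * pi) f = 0 ->
  2 * Int 0 (2 * pi) (fun t => f t ^+ 2) <= Int 0 (2 * pi) (fun t => f' t ^+ 2) +
  K * ((f pi - f 0) ^+ 2 + (f (pi / 2 + pi) - f (pi / 2)) ^+ 2).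
Proof.
have pi0 : 0 < pi :> R := pi_gt0 R.
(* Both parts are treated on length [pi / 2], where constants below [2] are admissible: the even
   part is [pi]-periodic with mean zero and is split once more by [wirtinger], the odd part falls
   under [dirichlet_bound] on two adjacent intervals. *)
pose c : R := Num.sqrt 2.
have c0 : 0 <= c by exact: sqrtr_ge0.
have c2 : c ^+ 2 = 2 by rewrite sqr_sqrtr.
have c3 : c < 2.
  by rewrite -(@ltr_pXn2r _ 2%N) ?nnegrE// c2; lra.
pose L : R := pi / 2.
have L0 : 0 < L by rewrite /L; lra.
have E2 : 2 * L = pi by rewrite /L; field.
have cL : c * L < pi by rewrite -E2 ltr_pM2r.
have T0 : 0 <= tan (c * L / 2).
  rewrite /tan divr_ge0//.
    apply: sin_ge0_pi; have : 0 <= c * L by rewrite mulr_ge0// ltW.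
    by move=> ?; apply/andP; split; lra.
  apply: cos_ge0_pihalf; have : 0 <= c * L by rewrite mulr_ge0// ltW.
  by move=> ?; apply/andP; split; lra.
(* Each of the boundary values [o 0] and [o L] is counted on both intervals, and passing to the full
   period doubles the sum again; the factor [4] is absorbed because the jumps of [f] are [- 2] times
   these values. *)
exists (c * tan (c * L / 2)).
  by rewrite mulr_ge0.
move=> f f' df cf' pf f0; have cf := derive_continuous df.
have pf' := derive_periodic df pf.
rewrite !Int_parts ?(ltW pi0)//.
set e := even_part f pi; set e' := even_part f' pi.
set o := odd_part f pi; set o' := odd_part f' pi.
have de x : is_derive x 1 e (e' x) by exact: even_part_derive.
have do_ x : is_derive x 1 o (o' x) by exact: odd_part_derive.
have ce' : continuous e' by exact: even_part_continuous.
have co' : continuous o' by exact: odd_part_continuous.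
have co : continuous o by exact: odd_part_continuous.
have h1 : 2 * Int 0 pi (fun t => e t ^+ 2) <= Int 0 pi (fun t => e' t ^+ 2).
  rewrite -c2 -E2; apply: (@wirtinger e e') => //.
  - by rewrite E2; exact: even_part_periodic.
  - exact: ltW.
  - by rewrite E2; move: f0; rewrite (@Int_even_part f f') ?(ltW pi0)// -/e; lra.
have h2 := dirichlet_bound 0 do_ co' (ltW L0) c0 cL.
have h3 := dirichlet_bound L do_ co' (ltW L0) c0 cL.
rewrite (@Int_split _ (fun t => o t ^+ 2) 0 L pi); [|continuous_fun|lra..].
rewrite (@Int_split _ (fun t => o' t ^+ 2) 0 L pi); [|continuous_fun|lra..].
have oE0 : f pi - f 0 = -2 * o 0 by rewrite /o /odd_part add0r; field.
have oE1 : f (pi / 2 + pi) - f (pi / 2) = - 2 * o L by rewrite /o /odd_part; field.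
have oE2 : o pi = - o 0.
  by have := odd_part_antiperiodic pf 0; rewrite add0r.
have LL : L + L = pi by rewrite -E2; ring.
move: h2 h3; rewrite oE0 oE1 add0r LL oE2 c2.
set T := tan _.
lra.
Qed.

End Wirtinger.

(** * The index form in the rotating frame *)

Section IndexForm.
Context {R : realType}.
Variables (alpha w th : R).
Hypothesis w2 : w ^+ 2 = 1.
Implicit Types (x : R) (p q : R -> R).

Definition radial p q t := p t * cos (w * t + th) + q t * sin (w * t + th).
Definition tangential p q t := - p t * sin (w * t + th) + q t * cos (w * t + th).

(** The Hessian of the potential at the circular solution, applied twice to the variation
    [(p, q)]. *)
Definition hessian_density p q t :=
  (alpha + 2) * radial p q t ^+ 2 - (p t ^+ 2 + q t ^+ 2).

Lemma unit_angular_velocity : w = 1 \/ w = -1.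
Proof. by move/eqP: w2; rewrite sqrf_eq1 => /orP[/eqP|/eqP]; [left|right]. Qed.

Lemma cos_phase_periodic : periodic (fun t => cos (w * t + th)) (2 * pi).
Proof.
have E (a : R) : cos (a + 2 * pi) = cos a by rewrite mulr_natl cosD2pi.
move=> t; case: unit_angular_velocity => ->; first by rewrite -[RHS]E; congr cos; ring.
by rewrite -[LHS]E; congr cos; ring.
Qed.

Lemma sin_phase_periodic : periodic (fun t => sin (w * t + th)) (2 * pi).
Proof.
have E (a : R) : sin (a + 2 * pi) = sin a by rewrite mulr_natl sinD2pi.
move=> t; case: unit_angular_velocity => ->; first by rewrite -[RHS]E; congr sin; ring.
by rewrite -[LHS]E; congr sin; ring.
Qed.

Lemma radial_periodic p q : periodic p (2 * pi) -> periodic q (2 * pi) ->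
  periodic (radial p q) (2 * pi).
Proof.
by move=> pp pq t; rewrite /radial pp pq cos_phase_periodic sin_phase_periodic.
Qed.

Lemma tangential_periodic p q : periodic p (2 * pi) -> periodic q (2 * pi) ->
  periodic (tangential p q) (2 * pi).
Proof.
by move=> pp pq t; rewrite /tangential pp pq cos_phase_periodic sin_phase_periodic.
Qed.

Lemma radial_continuous p q : continuous p -> continuous q -> continuous (radial p q).
Proof. by move=> cp cq; rewrite /radial; continuous_fun. Qed.

Lemma hessian_density_continuous p q : continuous p -> continuous q ->
  continuous (hessian_density p q).
Proof. by move=> cp cq; have cr := radial_continuous cp cq; rewrite /hessian_density; continuous_fun. Qed.

(* Since v' has mean zero, (v' + 2 w u)^2 >= 4 w m (v' + 2 w u) - 4 m^2, m the mean of
u, bounds the integral of the square below by 8 pi m^2. *)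
Lemma index_form_rotating p q p' q' :
  (forall x, is_derive x 1 p (p' x)) -> (forall x, is_derive x 1 q (q' x)) ->
  continuous p' -> continuous q' -> periodic p (2 * pi) -> periodic q (2 * pi) ->
  0 <= alpha ->
  exists2 f : R -> R, exists f' : R -> R,
    [/\ forall x : R, is_derive x 1 f (f' x), continuous f', periodic f (2 * pi),
      Int 0 (2 * pi) f = 0 &
    Int 0 (2 * pi) (fun t => f' t ^+ 2) - (2 - alpha) * Int 0 (2 * pi) (fun t => f t ^+ 2) <=
    Int 0 (2 * pi) (fun t => p' t ^+ 2) + Int 0 (2 * pi) (fun t => q' t ^+ 2)
      + Int 0 (2 * pi) (hessian_density p q)] &
    forall s t, f s - f t = radial p q s - radial p q t.
Proof.
move=> dp dq cp' cq' pp pq al0.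
have cp := derive_continuous dp; have cq := derive_continuous dq.
have pi0 : 0 < pi :> R := pi_gt0 R.
pose u := radial p q; pose v := tangential p q.
pose u' t := p' t * cos (w * t + th) + q' t * sin (w * t + th) + w * v t.
pose v' t := - p' t * sin (w * t + th) + q' t * cos (w * t + th) - w * u t.
have du x : is_derive x 1 u (u' x).
  by rewrite /u /u' /v /radial /tangential; derive_fun; ring.
have dv_ x : is_derive x 1 v (v' x).
  by rewrite /v /v' /u /radial /tangential; derive_fun; ring.
have cu := derive_continuous du; have cv := derive_continuous dv_.
have cu' : continuous u' by rewrite /u'; continuous_fun.
have cv' : continuous v' by rewrite /v'; continuous_fun.
pose m := Int 0 (2 * pi) u / (2 * pi).
have mE : Int 0 (2 * pi) u = 2 * pi * m by rewrite /m mulrCA divff ?mulr1// gt_eqF//; lra.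
have le2pi : 0 <= 2 * pi :> R by lra.
have IC (c : R) : Int 0 (2 * pi) (fun=> c) = c * (2 * pi) by rewrite IntC// subr0.
have cm : continuous (fun t => u t - m) by continuous_fun.
exists (fun t => u t - m); last by move=> s t; rewrite /u; ring.
exists u'; split => //.
- by move=> x; derive_fun; ring.
- by move=> t; rewrite /u radial_periodic.
- rewrite IntD; [|continuous_fun..]. by rewrite IC mE; ring.
(* In the rotating frame the squared velocity is [(u' - w v)^2 + (v' + w u)^2]. Adding [W'], whose
   integral is zero, cancels [u' v] and doubles [u v']; the terms [u^2 + v^2] cancel against the
   density, and [w ^ 2 = 1] completes the square. *)
pose W t := 2 * w * (u t * v t).
pose W' t := 2 * w * (u' t * v t + u t * v' t).
have dW x : is_derive x 1 W (W' x) by rewrite /W /W'; derive_fun; ring.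
have cW' : continuous W' by rewrite /W'; continuous_fun.
have pu : u (2 * pi) = u 0 by have := radial_periodic pp pq 0; rewrite add0r.
have pv : v (2 * pi) = v 0 by have := tangential_periodic pp pq 0; rewrite add0r.
have W0 : Int 0 (2 * pi) W' = 0.
  by rewrite (Int_FTC dW)// /W pu pv; ring.
have V0 : Int 0 (2 * pi) v' = 0.
  by rewrite (Int_FTC dv_)// pv; ring.
have cH := hessian_density_continuous cp cq.
have cX : continuous (fun t => (v' t + 2 * w * u t) ^+ 2) by continuous_fun.
have cs t : cos (w * t + th) ^+ 2 = 1 - sin (w * t + th) ^+ 2.
  by rewrite -(cos2Dsin2 (w * t + th)); ring.
have E : Int 0 (2 * pi) (fun t => p' t ^+ 2) + Int 0 (2 * pi) (fun t => q' t ^+ 2)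
      + Int 0 (2 * pi) (hessian_density p q) =
   Int 0 (2 * pi) (fun t => (v' t + 2 * w * u t) ^+ 2) +
   (Int 0 (2 * pi) (fun t => u' t ^+ 2) + (alpha - 2) * Int 0 (2 * pi) (fun t => u t ^+ 2)).
  rewrite -[LHS]addr0 -[X in _ + X = _]W0 -IntZ; last by continuous_fun.
  rewrite -!IntD; [|continuous_fun..].
  apply: eq_Rintegral => t _.
  have h1 : p' t ^+ 2 + q' t ^+ 2 = (u' t - w * v t) ^+ 2 + (v' t + w * u t) ^+ 2.
    by rewrite /u' /v'; have := cs t; set C := cos _; set S := sin _ => CS; ring: CS.
  have h2 : p t ^+ 2 + q t ^+ 2 = u t ^+ 2 + v t ^+ 2.
    rewrite /u /v /radial /tangential; have := cs t.
    by set C := cos _; set S := sin _ => CS; ring: CS.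
  by rewrite h1 /hessian_density h2 /W' -/u; ring: w2.
rewrite E.
have L1 : 8 * (2 * pi) * m ^+ 2 - 4 * m ^+ 2 * (2 * pi) <=
    Int 0 (2 * pi) (fun t => (v' t + 2 * w * u t) ^+ 2).
  have -> : 8 * (2 * pi) * m ^+ 2 - 4 * m ^+ 2 * (2 * pi) =
      Int 0 (2 * pi) (fun t => 4 * w * m * v' t + 8 * m * u t - 4 * m ^+ 2).
    rewrite !IntD ?IC; [|continuous_fun..].
    rewrite !IntZ; [|continuous_fun..].
    by rewrite V0 mE; ring.
  apply: Int_le; [continuous_fun|continuous_fun|] => x _.
  have := sqr_ge0 (v' x + 2 * w * u x - 2 * w * m).
  have -> : (v' x + 2 * w * u x - 2 * w * m) ^+ 2 =
    (v' x + 2 * w * u x) ^+ 2 - (4 * w * m * v' x + w ^+ 2 * (8 * m * u x - 4 * m ^+ 2)) by ring.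
  by rewrite w2; lra.
have L2 : Int 0 (2 * pi) (fun t => (u t - m) ^+ 2) =
    Int 0 (2 * pi) (fun t => u t ^+ 2) - (2 * pi) * m ^+ 2.
  have -> : Int 0 (2 * pi) (fun t => (u t - m) ^+ 2) =
    Int 0 (2 * pi) (fun t => u t ^+ 2 + (- 2 * m) * u t + m ^+ 2).
    by apply: eq_Rintegral => t _; ring.
  rewrite !IntD ?IC; [|continuous_fun..].
  rewrite IntZ; last by continuous_fun.
  by rewrite mE; ring.
rewrite L2.
(* The square gains [8 pi m^2], replacing [u] by [u - m] costs [(2 - alpha) 2 pi m^2]; this is the
   surplus. *)
have : 0 <= (2 + alpha) * (2 * pi) * m ^+ 2.
  have a2 : 0 <= 2 + alpha by lra.
  exact: mulr_ge0 (mulr_ge0 a2 le2pi) (sqr_ge0 m).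
lra.
Qed.

End IndexForm.

(** * Window averages *)

Section Mollification.
Context {R : realType}.
Local Notation mu := (@lebesgue_measure R).
Implicit Types (a b c x h e L : R) (f g F G w phi : R -> R).

Lemma continuous_bounded f a b : continuous f -> a <= b ->
  exists2 M, 0 <= M & forall x, a <= x <= b -> `|f x| <= M.
Proof.
move=> cf ab.
have cn : continuous (fun x => `|f x|).
  by move=> x; apply: (@continuous_comp _ _ _ f Num.norm); [exact: cf|exact: norm_continuous].
have [c cI cM] := EVT_max ab (continuous_subspaceT cn).
exists `|f c|; first exact: normr_ge0.
by move=> x xab; apply: cM; rewrite in_itv.
Qed.

(** Joint continuity of [f (y + h) - f y] gives the bound near each [(x, 0)]; the near-covering form
    of compactness turns these into one [d] for the whole interval. *)
Lemma uniform_shift f a b e : continuous f -> 0 < e ->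
  exists2 d, 0 < d & forall h, `|h| < d -> forall x, a <= x <= b -> `|f (x + h) - f x| <= e.
Proof.
move=> cf e0.
have /compact_near_coveringP nc : compact (`[a, b] : set R) by exact: segment_compact.
have : \forall h \near (0 : R), `[a, b] `<=` (fun x => `|f (x + h) - f x| <= e).
  apply: (nc R (nbhs (0 : R)) (fun h x => `|f (x + h) - f x| <= e)) => x xab.
  have e20 : 0 < e / 2 by rewrite divr_gt0.
  have cx := cf x.
  have c1 : {for (x, 0 : R), continuous (fun z : R * R => f (z.1 + z.2))}.
    apply: continuous_comp; first exact: add_continuous.
    by rewrite /= addr0; exact: cx.
  have c2 : {for (x, 0 : R), continuous (fun z : R * R => f z.1)}.
    by apply: continuous_comp; [exact: cvg_fst|exact: cx].
  have /cvgrPdist_le/(_ _ e20) n1 := c1.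
  have /cvgrPdist_le/(_ _ e20) n2 := c2.
  rewrite /= addr0 in n1; rewrite /= in n2.
  apply: filterS2 n1 n2 => -[y h]/= h1 h2.
  rewrite (_ : f (y + h) - f y = (f x - f y) - (f x - f (y + h))); last by ring.
  by rewrite (le_trans (ler_normB _ _))//; lra.
move=> [d /= d0 dP]; exists d => // h hd x xab.
by apply: (dP h) => /=; [rewrite sub0r normrN|rewrite in_itv].
Qed.

(* The mean over [t, t + h] of the function with antiderivative F. *)
Definition average F h t := (F (t + h) - F t) / h.

Lemma average_derive F f h x : (forall x, is_derive x 1 F (f x)) ->
  is_derive x 1 (average F h) ((f (x + h) - f x) / h).
Proof. by move=> dF; rewrite /average; derive_fun; ring. Qed.

Lemma average_periodic F f h L : (forall x, is_derive x 1 F (f x)) ->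
  periodic f L -> periodic (average F h) L.
Proof.
move=> dF pf x; rewrite /average; congr (_ / _).
have : F (x + h + L) - F (x + h) = F (x + L) - F x.
  apply: (@is_derive_0_is_cst _ (fun t => F (t + L) - F t)) => y.
  by derive_fun; rewrite pf; ring.
by rewrite (_ : x + h + L = x + L + h); [lra|ring].
Qed.

(** By the mean value theorem the average is a value of [f] in the window. *)
Lemma average_close F f h e x : (forall x, is_derive x 1 F (f x)) ->
  0 < h -> (forall k, 0 <= k <= h -> `|f (x + k) - f x| <= e) ->
  `|average F h x - f x| <= e.
Proof.
move=> dF h0 H; have xh : x <= x + h by lra.
have [c cI E] := MVT_segment xh (fun x _ => dF x) (continuous_subspaceT (derive_continuous dF)).
rewrite /average E (_ : x + h - x = h); last by ring.
rewrite mulfK ?gt_eqF//.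
move: cI; rewrite in_itv/= => /andP[c1 c2].
by have := H (c - x); rewrite (_ : x + (c - x) = c); [apply; apply/andP; split; lra|ring].
Qed.

(* Jensen's inequality on each window. *)
Lemma average_L2_le W w h L : (forall x, is_derive x 1 W (w x)) -> continuous w ->
  periodic w L -> 0 <= L -> 0 < h ->
  Int 0 L (fun t => average W h t ^+ 2) <= Int 0 L (fun t => w t ^+ 2).
Proof.
move=> dW cw pw L0 h0.
have cW := derive_continuous dW.
have cw2 : continuous (fun t => w t ^+ 2) by continuous_fun.
have [V dV] := antiderivative cw2.
have cV := derive_continuous dV.
have [U dU] := antiderivative cV.
have jensen t : average W h t ^+ 2 <= (V (t + h) - V t) / h.
  set m := average W h t.
  have th : t <= t + h by lra.
  have : 0 <= Int t (t + h) (fun s => (w s - m) ^+ 2) by apply: Int_ge0 => s _; exact: sqr_ge0.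
  have -> : Int t (t + h) (fun s => (w s - m) ^+ 2) =
      Int t (t + h) (fun s => w s ^+ 2 + (-2 * m) * w s + m ^+ 2).
    by apply: eq_Rintegral => s _; ring.
  rewrite !IntD; [|continuous_fun..].
  rewrite IntZ; last by continuous_fun.
  rewrite IntC// (Int_FTC dV)// (Int_FTC dW)//.
  have -> : W (t + h) - W t = m * h by rewrite /m /average divfK// gt_eqF.
  rewrite ler_pdivlMr//; lra.
have -> : Int 0 L (fun t => w t ^+ 2) = Int 0 L (fun t => (V (t + h) - V t) / h).
  (* Averaging preserves the integral over a period. As [U'' = w^2] and [w] is periodic, [D] has the
     constant derivative [A], hence [D h - D 0 = A * h]. *)
  pose D s := U (L + s) - U s.
  set A := Int 0 L (fun t => w t ^+ 2).
  have EA : A = V L - V 0 by exact: Int_FTC dV cw2 L0.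
  have pV s : V (L + s) - V s = A.
    rewrite EA -[L in RHS]addr0.
    apply: (@is_derive_0_is_cst _ (fun t => V (L + t) - V t)) => y.
    by derive_fun; rewrite (addrC L y) pw; ring.
  have DE : D h - A * h = D 0 - A * 0.
    apply: (@is_derive_0_is_cst _ (fun t => D t - A * t)) => y.
    by rewrite /D; derive_fun; rewrite -(pV y); ring.
  have dX x : is_derive x 1 (fun t => (U (t + h) - U t) / h) ((V (x + h) - V x) / h).
    by derive_fun; ring.
  rewrite (Int_FTC dX) //; last by continuous_fun.
  move: DE; rewrite /D mulr0 subr0 !addr0 add0r => DE.
  have -> : A = A * h / h by rewrite mulfK// gt_eqF.
  by rewrite -mulrBl; congr (_ / _); lra.
by apply: Int_le => //; rewrite /average; continuous_fun.
Qed.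

End Mollification.

(** * Square-integrable functions and weak derivatives *)

Section SquareIntegrable.
Context {R : realType}.
Local Notation mu := (@lebesgue_measure R).
Local Notation C := (@circle R).
Implicit Types (a b c x h e L : R) (f g F G w phi : R -> R).

Lemma circleE : C = `[0, 2 * pi].
Proof. by rewrite /circle (mulr_natl pi 2). Qed.

Lemma le0_2pi : 0 <= 2 * pi :> R.
Proof. by rewrite mulr_ge0// pi_ge0. Qed.

Lemma measurable_circle : measurable (C : set (measurableTypeR R)).
Proof. exact: measurable_itv. Qed.
#[local] Hint Resolve measurable_circle : core.

Definition L2 f := measurable_fun C f /\
  mu.-integrable C (fun t => (f t ^+ 2)%:E).

Lemma circle_integrable f : continuous f -> mu.-integrable C (EFin \o f).
Proof. exact: continuous_integrable. Qed.

Lemma L2_continuous f : continuous f -> L2 f.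
Proof.
move=> cf; split.
  by have /integrableP[/measurable_EFinP] := circle_integrable cf.
by apply: (@circle_integrable (fun t => f t ^+ 2)); continuous_fun.
Qed.

Lemma L2_mul f g : L2 f -> L2 g -> mu.-integrable C (fun t => (f t * g t)%:E).
Proof.
move=> [mf if2] [mg ig2].
have ifg : mu.-integrable C (fun t => (f t ^+ 2)%:E + (g t ^+ 2)%:E)%E by exact: integrableD.
apply: le_integrable ifg => //.
  by apply/measurable_EFinP; exact: measurable_funM.
move=> t _; rewrite -EFinD !abse_EFin lee_fin.
rewrite [leRHS]ger0_norm; last by rewrite addr_ge0// sqr_ge0.
rewrite ler_norml; have := sqr_ge0 (f t + g t); have := sqr_ge0 (f t - g t).
rewrite !expr2 => h1 h2; have := sqr_ge0 (f t); have := sqr_ge0 (g t); rewrite !expr2 => h3 h4.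
by apply/andP; split; lra.
Qed.

Lemma L2_add f g : L2 f -> L2 g -> L2 (fun t => f t + g t).
Proof.
move=> Lf Lg; split; first by apply: measurable_funD; [exact: Lf.1|exact: Lg.1].
have h1 := integrableD measurable_circle (L2_mul Lf Lf) (L2_mul Lf Lg).
have h2 := integrableD measurable_circle (L2_mul Lg Lf) (L2_mul Lg Lg).
have h3 := integrableD measurable_circle h1 h2.
apply: eq_integrable h3 => // t _ /=.
by rewrite -!EFinD; congr (_%:E); ring.
Qed.

Lemma L2_scale c f : L2 f -> L2 (fun t => c * f t).
Proof.
move=> Lf; split; first by apply: measurable_funM; [|exact: Lf.1].
have h := integrableZl measurable_circle (c ^+ 2) Lf.2.
apply: eq_integrable h => // t _ /=.
by rewrite -!EFinM; congr (_%:E); ring.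
Qed.

Definition inner f g := \int[mu]_(t in C) (f t * g t).

Lemma innerC f g : inner f g = inner g f.
Proof. by apply: eq_Rintegral => t _; rewrite mulrC. Qed.

Lemma innerDl f g w : L2 f -> L2 g -> L2 w -> inner (fun t => f t + g t) w = inner f w + inner g w.
Proof.
move=> Lf Lg Lw; rewrite /inner -RintegralD//; [|exact: L2_mul..].
by apply: eq_Rintegral => t _; rewrite mulrDl.
Qed.

Lemma innerZl c f g : L2 f -> L2 g -> inner (fun t => c * f t) g = c * inner f g.
Proof.
move=> Lf Lg; rewrite /inner -RintegralZl//; last exact: L2_mul.
by apply: eq_Rintegral => t _; rewrite mulrA.
Qed.

Lemma innerDr f g w : L2 f -> L2 g -> L2 w -> inner w (fun t => f t + g t) = inner w f + inner w g.
Proof. by move=> *; rewrite innerC innerDl// (innerC f) (innerC g). Qed.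

Lemma innerZr c f g : L2 f -> L2 g -> inner f (fun t => c * g t) = c * inner f g.
Proof. by move=> *; rewrite innerC innerZl// innerC. Qed.

Lemma inner_line r f g : L2 f -> L2 g ->
  inner (fun t => f t + r * g t) (fun t => f t + r * g t) = inner f f + 2 * r * inner f g + r ^+ 2 * inner g g.
Proof.
move=> Lf Lg; have Lr := L2_scale r Lg; have Ld := L2_add Lf Lr.
rewrite (innerDl Lf Lr Ld) (innerDr Lf Lr Lf) (innerDr Lf Lr Lr).
by rewrite (innerZl r Lg Lf) (innerZl r Lg Lr) (innerZr r Lf Lg) (innerZr r Lg Lg) (innerC g f); ring.
Qed.

Lemma inner_ge0 f : 0 <= inner f f.
Proof. by apply: Rintegral_ge0 => t _; rewrite -expr2 sqr_ge0. Qed.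

Lemma inner_Int f g : inner f g = Int 0 (2 * pi) (fun t => f t * g t).
Proof. by rewrite /inner circleE. Qed.

Lemma inner_sqr f : inner f f = \int[mu]_(t in C) (f t ^+ 2).
Proof. by apply: eq_Rintegral => t _; rewrite expr2. Qed.

Definition weak_der f g := forall phi, test_function phi ->
  inner f (derive1 phi) = - inner g phi.

Lemma test_functionP phi phi' : (forall x, is_derive x 1 phi (phi' x)) ->
  continuous phi' -> periodic phi (2 * pi) -> test_function phi /\ derive1 phi = phi'.
Proof.
move=> dphi cphi' pphi.
have E : derive1 phi = phi' by apply/funext => x; rewrite derive1E; case: (dphi x).
split=> //; split.
- by rewrite -(mulr_natl pi 2).
- by move=> x; case: (dphi x).
- by rewrite E.
Qed.

Lemma test_function_derive phi : test_function phi ->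
  [/\ forall x, is_derive x 1 phi (derive1 phi x), continuous (derive1 phi) & periodic phi (2 * pi)].
Proof.
move=> [pphi dphi cphi]; split => //; last by rewrite (mulr_natl pi 2).
by move=> x; rewrite derive1E; apply: derivableP.
Qed.

Lemma weak_der_C1 f f' : (forall x, is_derive x 1 f (f' x)) -> continuous f' ->
  periodic f (2 * pi) -> weak_der f f'.
Proof.
move=> df cf' pf phi /test_function_derive[dphi cphi' pphi].
have cphi := derive_continuous dphi; have cf := derive_continuous df.
set phi' := derive1 phi in dphi cphi' *.
rewrite !inner_Int.
have : Int 0 (2 * pi) (fun t => f t * phi' t + f' t * phi t) = 0.
  have dP x : is_derive x 1 (fun t => f t * phi t) (f x * phi' x + f' x * phi x).
    by derive_fun; ring.
  rewrite (Int_FTC dP) ?le0_2pi//; last by continuous_fun.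
  by have := pf 0; have := pphi 0; rewrite !add0r => -> ->; rewrite subrr.
rewrite IntD; [|continuous_fun..].
lra.
Qed.

Lemma weak_der_add f g f' g' : continuous f -> continuous g -> L2 f' -> L2 g' ->
  weak_der f f' -> weak_der g g' -> weak_der (fun t => f t + g t) (fun t => f' t + g' t).
Proof.
move=> cf cg Lf' Lg' wf wg phi tphi.
have [dphi cphi' _] := test_function_derive tphi.
have cphi := derive_continuous dphi.
rewrite !innerDl//; try exact: L2_continuous.
by rewrite wf// wg// opprD.
Qed.

Lemma weak_der_scale c f f' : continuous f -> L2 f' ->
  weak_der f f' -> weak_der (fun t => c * f t) (fun t => c * f' t).
Proof.
move=> cf Lf' wf phi tphi.
have [dphi cphi' _] := test_function_derive tphi.
have cphi := derive_continuous dphi.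
rewrite !innerZl//; try exact: L2_continuous.
by rewrite wf// mulrN.
Qed.

(* Test the weak derivative against the average of w t := (f (t + h) - f t) / h over
[t - h, t]. *)
Lemma difference_quotient_L2_le f g h : continuous f -> periodic f (2 * pi) ->
  L2 g -> weak_der f g -> 0 < h ->
  Int 0 (2 * pi) (fun t => ((f (t + h) - f t) / h) ^+ 2) <= inner g g.
Proof.
move=> cf pf Lg wfg h0.
pose w t := (f (t + h) - f t) / h.
have cw : continuous w by rewrite /w; continuous_fun.
have pw : periodic w (2 * pi).
  by move=> t; rewrite /w pf (_ : t + 2 * pi + h = t + h + 2 * pi) ?pf//; ring.
have [W dW] := antiderivative cw.
have cW := derive_continuous dW.
pose phi t := average W h (t - h).
have dphi x : is_derive x 1 phi ((w x - w (x - h)) / h).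
  have dA y := average_derive h y dW.
  by rewrite /phi; derive_fun; rewrite subrK; ring.
have pphi : periodic phi (2 * pi).
  move=> t; rewrite /phi -(average_periodic h dW pw (t - h)).
  by congr average; ring.
have cphi' : continuous (fun x => (w x - w (x - h)) / h) by continuous_fun.
have [tphi phi'E] := test_functionP dphi cphi' pphi.
have cphi := derive_continuous dphi.
have Lphi := L2_continuous cphi.
have := wfg _ tphi; rewrite phi'E.
(* Summation by parts: a translation by [h], harmless by periodicity, moves the difference quotient
   from [w] to [f]. *)
have -> : inner f (fun x => (w x - w (x - h)) / h) = - inner w w.
  rewrite !inner_Int.
  have E1 : Int 0 (2 * pi) (fun t => f t * w (t - h)) = Int 0 (2 * pi) (fun t => f (t + h) * w t).
    have -> : Int 0 (2 * pi) (fun t => f t * w (t - h)) =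
              Int 0 (2 * pi) (fun t => (fun s => f (s + h) * w s) (t - h)).
      by apply: eq_Rintegral => t _; rewrite subrK.
    rewrite (@Int_shift _ (fun s => f (s + h) * w s)) ?le0_2pi//; last by continuous_fun.
    rewrite add0r (_ : 2 * pi - h = - h + 2 * pi); last by ring.
    rewrite (@Int_periodic _ (fun s => f (s + h) * w s)) ?le0_2pi//; first by continuous_fun.
    move=> t; rewrite pw (_ : t + 2 * pi + h = t + h + 2 * pi) ?pf//; ring.
  have -> : Int 0 (2 * pi) (fun t => f t * ((w t - w (t - h)) / h)) =
      Int 0 (2 * pi) (fun t => h^-1 * (f t * w t) + - (h^-1 * (f t * w (t - h)))).
    by apply: eq_Rintegral => t _; ring.
  rewrite IntD; [|continuous_fun..].
  rewrite IntN; last by continuous_fun.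
  rewrite !IntZ; [|continuous_fun..].
  rewrite E1 -!IntZ; [|continuous_fun..].
  rewrite -!IntN; [|continuous_fun..].
  rewrite -IntD; [|continuous_fun..].
  by apply: eq_Rintegral => t _; rewrite /w; field; rewrite gt_eqF.
move=> /oppr_inj E.
have ww : inner w w = Int 0 (2 * pi) (fun t => w t ^+ 2).
  by rewrite inner_sqr circleE.
rewrite -/w -ww.
have le1 : inner phi phi <= inner w w.
  rewrite ww inner_sqr circleE.
  have cA : continuous (average W h) by rewrite /average; continuous_fun.
  rewrite (@Int_shift _ (fun t => average W h t ^+ 2)) ?le0_2pi//; last by continuous_fun.
  rewrite add0r (_ : 2 * pi - h = - h + 2 * pi); last by ring.
  rewrite (@Int_periodic _ (fun t => average W h t ^+ 2)) ?le0_2pi//; [|continuous_fun|].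
    exact: average_L2_le dW cw pw le0_2pi h0.
  by move=> t; rewrite (average_periodic h dW pw).
(* With [inner g phi = inner w w] and [inner phi phi <= inner w w], expanding the square of
   [g - phi] replaces the Cauchy-Schwarz inequality. *)
have := inner_ge0 (fun t => g t + -1 * phi t).
rewrite (inner_line (-1) Lg Lphi); move: E le1; lra.
Qed.

End SquareIntegrable.

(** * The du Bois-Reymond lemma *)

Section DuBoisReymond.
Context {R : realType}.
Local Notation mu := (@lebesgue_measure R).
Local Notation C := (@circle R).
Implicit Types (a b c x h e L : R) (f g F G w phi psi d : R -> R).

(** A window average of [psi] is a test function uniformly close to [psi], so [k] is also the
    product of [d] with the small remainder [r]. If [k] were nonzero, the square of [d + a r] would
    have a negative integral for a suitable [a]. *)
Lemma orthogonal_continuous d psi : L2 d ->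
  (forall phi, test_function phi -> inner d phi = 0) ->
  continuous psi -> periodic psi (2 * pi) -> inner d psi = 0.
Proof.
move=> Ld dtest cpsi ppsi; apply/eqP; rewrite -[_ == _]negbK; apply/negP => k0.
have pi0 : 0 < pi :> R := pi_gt0 R.
set k := inner d psi in k0.
have A0 := inner_ge0 d; set A := inner d d in A0.
(* Then [2 a k = - (A + 2 pi + 1)], and [e] below is small enough for [a^2 inner r r <= 2 pi]; the
   expanded square is at most [-1]. *)
pose a := - (A + 2 * pi + 1) / (2 * k).
pose e := (`|a| + 1)^-1.
have na : 0 <= `|a| := normr_ge0 a.
have e0 : 0 < e by rewrite invr_gt0; lra.
have [dl dl0 Hdl] := @uniform_shift _ psi 0 (2 * pi) e cpsi e0.
have [F dF] := antiderivative cpsi.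
pose h := dl / 2; have h0 : 0 < h by rewrite divr_gt0.
pose phi := average F h.
have dphi x := average_derive h x dF.
have cphi' : continuous (fun x => (psi (x + h) - psi x) / h) by continuous_fun.
have [tphi _] := test_functionP dphi cphi' (average_periodic h dF ppsi).
have cphi : continuous phi := derive_continuous dphi.
pose r t := psi t - phi t.
have cr : continuous r by rewrite /r; continuous_fun.
have Lr := L2_continuous cr; have Lpsi := L2_continuous cpsi; have Lphi := L2_continuous cphi.
have kr : inner d r = k.
  have -> : inner d r = inner d (fun t => psi t + (-1) * phi t).
    by apply: eq_Rintegral => t _; rewrite /r mulN1r.
  rewrite innerDr//; last exact: L2_scale.
  by rewrite innerZr// (dtest _ tphi) mulr0 addr0.
have rr : inner r r <= e ^+ 2 * (2 * pi).
  rewrite inner_Int -[X in e ^+ 2 * X]subr0 -IntC ?le0_2pi//.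
  apply: Int_le; [continuous_fun|continuous_fun|] => x xI.
  rewrite -expr2 -real_normK ?num_real// lerXn2r ?nnegrE ?(ltW e0)//.
  rewrite /r distrC; apply: (average_close dF h0) => s /andP[s0 sh].
  apply: Hdl => //; rewrite ger0_norm//; move: sh; rewrite /h; lra.
have := inner_ge0 (fun t => d t + a * r t).
rewrite (inner_line a Ld Lr) kr -/A.
have ak : a * k = - (A + 2 * pi + 1) / 2 by rewrite /a; field.
have ae : a ^+ 2 * e ^+ 2 <= 1.
  rewrite -exprMn -real_normK ?num_real// expr_le1 ?normr_ge0//.
  rewrite normrM (gtr0_norm e0) /e ler_pdivrMr; lra.
have arr : a ^+ 2 * inner r r <= 2 * pi.
  apply: (@le_trans _ _ (a ^+ 2 * (e ^+ 2 * (2 * pi)))).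
    by rewrite ler_wpM2l// sqr_ge0.
  by rewrite mulrA -[leRHS]mul1r ler_wpM2r// le0_2pi.
lra.
Qed.

(** As [n] grows, [clip (n * y)] tends to the indicator of [0 < y] through continuous functions of
    [y]. *)
Definition clip (y : R) : R := Num.max 0 (Num.min 1 y).

Lemma clip_continuous f : continuous f -> continuous (fun t => clip (f t)).
Proof.
move=> cf x; apply: (@continuous_max _ _ (fun=> 0) (fun t => Num.min 1 (f t))).
  exact: cvg_cst.
by apply: (@continuous_min _ _ (fun=> 1) f); [exact: cvg_cst|exact: cf].
Qed.

Lemma clip_bound y : 0 <= clip y <= 1.
Proof. by rewrite /clip le_max lexx ge_max ge_min lexx ler01. Qed.

(* Arcs of the circle are the superlevel sets of translated cosines. *)
Lemma arc_cos x t : 0 < x < 2 * pi -> 0 <= t <= 2 * pi ->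
  (cos (x / 2) < cos (t - x / 2)) = (0 < t < x).
Proof.
move=> /andP[x0 x1] /andP[t0 t1].
have E s : 0 <= s <= pi -> (cos (x / 2) < cos s) = (s < x / 2).
  by move=> sI; apply: ltr_cos; rewrite in_itv/= ?sI//; apply/andP; split; lra.
have [ht|ht] := leP t (x / 2).
  rewrite -(cosN (t - x / 2)) opprB E; last by apply/andP; split; lra.
  by apply/idP/idP => [?|/andP[? ?]]; [apply/andP; split|]; lra.
have [ht'|ht'] := leP (t - x / 2) pi.
  rewrite E; last by apply/andP; split; lra.
  by apply/idP/idP => [?|/andP[? ?]]; [apply/andP; split|]; lra.
rewrite -(cosN (t - x / 2)) -(cosD2pi (- (t - x / 2))) E -(mulr_natl pi 2); last by apply/andP; split; lra.
by apply/idP/idP => [?|/andP[? ?]]; [apply/andP; split|]; lra.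
Qed.

Lemma L2_integrable d : L2 d -> mu.-integrable C (EFin \o d).
Proof.
move=> Ld; have := L2_mul Ld (L2_continuous (@continuous_fun_cst R 1)).
by apply: eq_integrable; [exact: measurable_circle|] => t _; rewrite mulr1.
Qed.

(** The indicator of []0, x[] is the pointwise limit on the circle of the [psi n], which are
    periodic because they are built from a cosine. Each is orthogonal to [d], and [|d|] dominates
    the products. *)
Lemma orthogonal_primitive d x : L2 d ->
  (forall phi, test_function phi -> inner d phi = 0) ->
  0 < x < 2 * pi -> Int 0 x d = 0.
Proof.
move=> Ld dtest xI.
pose y t := cos (t - x / 2) - cos (x / 2).
have cy : continuous y by rewrite /y; continuous_fun.
pose psi n t := clip (n%:R * y t).
have cpsi n : continuous (psi n) by apply: clip_continuous; continuous_fun.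
have ppsi n : periodic (psi n) (2 * pi).
  move=> t; rewrite /psi /y; congr (clip (_ * (_ - _))).
  by rewrite -[RHS]cosD2pi -(mulr_natl pi 2); congr cos; ring.
have E0 n := orthogonal_continuous Ld dtest (cpsi n) (ppsi n).
pose I := (`]0, x[ : set R).
have id := L2_integrable Ld.
have IC : I `<=` C.
  move=> t /=; rewrite circleE /I/= !in_itv/= => /andP[t0 tx].
  by case/andP: xI => x0 x2; apply/andP; split; lra.
have ind_m : measurable_fun C (EFin \o (d \_ I)).
  apply/measurable_EFinP/(@measurable_restrict _ _ _ _ _ C).
  - exact: measurable_itv.
  - exact: measurable_circle.
  - by apply: measurable_funS Ld.1; [exact: measurable_circle|exact: subIsetl].
have cv : {ae mu, forall t, C t -> (fun n => (d t * psi n t)%:E) @ \oo --> (EFin \o (d \_ I)) t}.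
  apply: aeW => t Ct; apply: cvg_near_cst.
  move: Ct; rewrite circleE/= in_itv/= => tI.
  have := arc_cos xI tI; rewrite patchE.
  have [tI0 yt|tI0 yt] := boolP (t \in I).
    have : 0 < y t.
      by rewrite subr_gt0 yt; move: tI0; rewrite inE /I/= in_itv.
    move=> y0; near=> n; rewrite /psi /clip.
    have : 1 <= n%:R * y t.
      rewrite -ler_pdivrMr// mul1r; near: n; exact: nbhs_infty_ger.
    by move=> /min_idPl ->; rewrite (max_idPr _) ?mulr1// ler01.
  have yt0 : y t <= 0.
    rewrite subr_le0 leNgt yt; move: tI0; apply: contra.
    by rewrite inE /I/= in_itv.
  near=> n; rewrite /psi /clip (max_idPl _) ?mulr0// ge_min.
  by rewrite mulr_ge0_le0 ?orbT.
have bd : {ae mu, forall t n, C t -> `|(d t * psi n t)%:E| <= (`|d t|%:E)}%E.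
  apply: aeW => t n Ct; rewrite abse_EFin lee_fin normrM.
  have /andP[c0 c1] := clip_bound (n%:R * y t).
  by rewrite -[leRHS]mulr1 ler_wpM2l// /psi ger0_norm.
have [_ _] := @dominated_convergence _ _ _ mu C (@measurable_circle R)
  (fun n t => (d t * psi n t)%:E) (EFin \o (d \_ I)) (fun t => `|d t|%:E)
  (fun n => measurable_int _ (L2_mul Ld (L2_continuous (cpsi n)))) ind_m cv (integrable_abse id) bd.
have -> : [sequence (\int[mu]_(t in C) (d t * psi n t)%:E)%E]_n = (fun=> 0%E).
  apply/funext => n /=.
  have := E0 n; rewrite /inner /Rintegral => E.
  have h := integrable_fin_num (@measurable_circle R) (L2_mul Ld (L2_continuous (cpsi n))).
  by rewrite -[LHS](fineK h) E.
move=> /(cvg_unique _ (@cvg_cst _ _ _ _ _)) => /(_ (@ereal_hausdorff R)) E.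
have : \int[mu]_(t in C `&` I) d t = 0.
  by rewrite Rintegral_mkcondr /Rintegral -E.
rewrite setIC (setIidl IC) Rintegral_itv_obnd_cbnd.
  rewrite Rintegral_itv_bndo_bndc//.
  apply: integrableS id; [exact: measurable_circle|exact: measurable_itv|].
  by move=> t /=; rewrite circleE/= !in_itv/= => /andP[? ?]; apply/andP; split; lra.
by apply: integrableS id; [exact: measurable_circle|exact: measurable_itv|exact: IC].
Unshelve. all: by end_near.
Qed.

(** At a Lebesgue point inside the interval, [d] is the derivative of its primitive, which is
    identically zero. The two end points join the null set, since the primitive is known to vanish
    only between them. *)
Lemma du_bois_reymond d : L2 d ->
  (forall phi, test_function phi -> inner d phi = 0) ->
  {ae mu, forall t, C t -> d t = 0}.
Proof.
move=> Ld dtest; have id := L2_integrable Ld.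
have := lebesgue_differentiation (integrable_locally_restrict (@measurable_circle R) id).
have n0 : mu.-negligible [set (0 : R)].
  by apply/negligibleP; [exact: measurable_set1|exact: lebesgue_measure_set1].
have n1 : mu.-negligible [set (2 * pi : R)].
  by apply/negligibleP; [exact: measurable_set1|exact: lebesgue_measure_set1].
move=> /negligibleU /(_ n0) /negligibleU /(_ n1).
apply: negligibleS => t /= /not_implyP[Ct dt0].
apply: contrapT => /not_orP[/not_orP[/contrapT lpt t0] t1].
move: (Ct); rewrite circleE/= in_itv/= => /andP[tge tle].
have tgt : 0 < t by rewrite lt_neqAle tge andbT; apply/eqP => E; apply: t0.
have tlt : t < 2 * pi by rewrite lt_neqAle tle andbT; apply/eqP => E; apply: t1.
apply: dt0.
have rC (y : R) : y <= 2 * pi -> {in `[0, y]%classic, d \_ C =1 d}.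
  move=> y2 s; rewrite inE/= in_itv/= => /andP[s0 sy].
  by rewrite patchE mem_set// circleE/= in_itv/= s0 (le_trans sy).
have int' : mu.-integrable `[0, 2 * pi] (EFin \o (d \_ C)).
  rewrite -circleE; apply: eq_integrable id; first exact: measurable_circle.
  by move=> s sC; rewrite /= patchE sC.
have [_] := @FTC1_lebesgue_pt _ _ (BLeft 0) t (2 * pi) tlt int' tgt lpt.
rewrite patchE mem_set// => <-; rewrite derive1E.
rewrite (@near_eq_derive _ _ _ _ (cst 0)) ?derive_cst//.
near=> y.
have y0 : 0 < y by near: y; exact: lt_nbhsr.
have y2 : y < 2 * pi by near: y; exact: lt_nbhsl.
transitivity (Int 0 y d); first by apply: eq_Rintegral; exact: (rC y (ltW y2)).
by rewrite (orthogonal_primitive Ld dtest)// y0 y2.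
Unshelve. all: by end_near.
Qed.

Lemma weak_derivative_norm_unique f g1 g2 : L2 g1 -> L2 g2 -> weak_der f g1 -> weak_der f g2 ->
  inner g1 g1 = inner g2 g2.
Proof.
move=> L1 L2' w1 w2.
have Ln : L2 (fun t => -1 * g2 t) by exact: L2_scale.
pose d t := g1 t + -1 * g2 t.
have Ld : L2 d by exact: L2_add.
have dtest phi : test_function phi -> inner d phi = 0.
  move=> tphi; have [dphi _ _] := test_function_derive tphi.
  have Lp := L2_continuous (derive_continuous dphi).
  rewrite innerDl// innerZl//; have := w1 _ tphi; have := w2 _ tphi; lra.
have ae0 := du_bois_reymond Ld dtest.
rewrite /inner /Rintegral; congr fine; apply: ae_eq_integral.
- exact: measurable_circle.
- exact: (measurable_int mu (L2_mul L1 L1)).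
- exact: (measurable_int mu (L2_mul L2' L2')).
apply: filterS ae0; first exact: (ae_filter_ringOfSetsType mu).
move=> t dt Ct; have := dt Ct; rewrite /d => dt0.
by have -> : g1 t = g2 t by lra.
Qed.

End DuBoisReymond.

(** * Lower bound of the index form on W12 *)

Section IndexFormW12.
Context {R : realType}.
Variables (alpha w th : R).
Hypothesis w2 : w ^+ 2 = 1.
Hypothesis alpha0 : 0 <= alpha.
Local Notation mu := (@lebesgue_measure R).
Local Notation C := (@circle R).
Implicit Types (x h e : R) (p q r g : R -> R).
Local Notation rad := (radial w th).
Local Notation hess := (hessian_density alpha w th).

(** The penalty of [wirtinger_constrained]; its vanishing encodes both linear conditions at once. *)
Definition defect p q := (rad p q pi - rad p q 0) ^+ 2 +
  (rad p q (pi / 2 + pi) - rad p q (pi / 2)) ^+ 2.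

(** For [1 <= alpha] the factor [2 - alpha] is at most [1] and the sharp Wirtinger inequality
    suffices; otherwise it is at most [2] and the constrained inequality pays with the penalty. *)
Lemma index_form_C1 : exists K : R, [/\ 0 <= K, 1 <= alpha -> K = 0 &
  forall p q p' q', (forall x, is_derive x 1 p (p' x)) -> (forall x, is_derive x 1 q (q' x)) ->
  continuous p' -> continuous q' -> periodic p (2 * pi) -> periodic q (2 * pi) ->
  0 <= Int 0 (2 * pi) (fun t => p' t ^+ 2) + Int 0 (2 * pi) (fun t => q' t ^+ 2)
      + Int 0 (2 * pi) (hess p q) + K * defect p q].
Proof.
have a0 := alpha0.
have [a1|a1] := leP 1 alpha.
  exists 0; split => // p q p' q' dp dq cp' cq' pp pq.
  have [f [f' [df cf' pf f0 ineq]] _] := index_form_rotating th w2 dp dq cp' cq' pp pq a0.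
  have := wirtinger_circle df cf' pf f0.
  set A := Int 0 (2 * pi) (fun t => f t ^+ 2) in ineq *.
  have A0 : 0 <= A by apply: Int_ge0 => x _; exact: sqr_ge0.
  have : 0 <= (alpha - 1) * A by rewrite mulr_ge0// subr_ge0.
  lra.
have [K K0 HK] := @wirtinger_constrained R.
exists K; split; [exact: K0|by []|].
move=> p q p' q' dp dq cp' cq' pp pq.
have [f [f' [df cf' pf f0 ineq]] fE] := index_form_rotating th w2 dp dq cp' cq' pp pq a0.
have := HK _ _ df cf' pf f0; rewrite !fE -/(defect p q).
set A := Int 0 (2 * pi) (fun t => f t ^+ 2) in ineq *.
have A0 : 0 <= A by apply: Int_ge0 => x _; exact: sqr_ge0.
have : 0 <= alpha * A by rewrite mulr_ge0.
lra.
Qed.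

Lemma radial_le p q t M : `|p t| <= M -> `|q t| <= M -> `|rad p q t| <= 2 * M.
Proof.
move=> pM qM; rewrite /radial (le_trans (ler_normD _ _))// !normrM.
have C1 : `|cos (w * t + th)| <= 1 by rewrite ler_norml cos_geN1 cos_le1.
have S1 : `|sin (w * t + th)| <= 1 by rewrite ler_norml sin_geN1 sin_le1.
have h1 : `|p t| * `|cos (w * t + th)| <= `|p t| by rewrite ler_piMr.
have h2 : `|q t| * `|sin (w * t + th)| <= `|q t| by rewrite ler_piMr.
lra.
Qed.

Lemma defect_le p q r s e : 0 <= e <= 1 -> defect p q = 0 ->
  (forall t, 0 <= t <= 2 * pi -> `|r t - p t| <= e) ->
  (forall t, 0 <= t <= 2 * pi -> `|s t - q t| <= e) -> defect r s <= 32 * e.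
Proof.
move=> /andP[e0 e1] dpq rp sq; have pi0 : 0 < pi :> R := pi_gt0 R.
have rb t : 0 <= t <= 2 * pi -> `|rad r s t - rad p q t| <= 2 * e.
  move=> tI; have -> : rad r s t - rad p q t = rad (fun t => r t - p t) (fun t => s t - q t) t.
    by rewrite /radial; ring.
  by apply: radial_le; [exact: rp|exact: sq].
have e2 : e * e <= e * 1 by rewrite ler_wpM2l.
have sqb x y : 0 <= x <= 2 * pi -> 0 <= y <= 2 * pi -> rad p q x - rad p q y = 0 ->
    (rad r s x - rad r s y) ^+ 2 <= 16 * e.
  move=> /rb hx /rb hy xy.
  have -> : rad r s x - rad r s y = (rad r s x - rad p q x) - (rad r s y - rad p q y).
    by move: xy; lra.
  rewrite -real_normK ?num_real// expr2.
  have hb : `|(rad r s x - rad p q x) - (rad r s y - rad p q y)| <= 4 * e.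
    by rewrite (le_trans (ler_normB _ _))//; move: hx hy; lra.
  by apply: (@le_trans _ _ (4 * e * (4 * e))); [rewrite ler_pM|move: e2; lra].
move/eqP: dpq; rewrite paddr_eq0 ?sqr_ge0// !sqrf_eq0 => /andP[/eqP z1 /eqP z2].
have i0 : (0 : R) <= (0 : R) <= 2 * pi by rewrite lexx le0_2pi.
have i1 : 0 <= (pi : R) <= 2 * pi by apply/andP; split; lra.
have i2 : 0 <= (pi / 2 : R) <= 2 * pi by apply/andP; split; lra.
have i3 : 0 <= (pi / 2 + pi : R) <= 2 * pi by apply/andP; split; lra.
rewrite /defect (_ : 32 * e = 16 * e + 16 * e); last by ring.
by apply: lerD; apply: sqb.
Qed.

(** An upper bound linear in [e] is wanted: [(r - p)^2] and [(s - q)^2] enter with a minus sign and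
    are dropped, and [e * e <= e]. *)
Lemma hessian_density_perturb p q r s t M e : `|p t| <= M -> `|q t| <= M ->
  `|r t - p t| <= e -> `|s t - q t| <= e -> 0 <= e <= 1 ->
  hess r s t - hess p q t <= ((alpha + 2) * (8 * M + 4) + 4 * M) * e.
Proof.
move=> pM qM re se /andP[e0 e1]; have a0 := alpha0.
have M0 : 0 <= M by exact: le_trans (normr_ge0 _) pM.
pose a x := r x - p x; pose b x := s x - q x.
have uM := radial_le pM qM.
have ve : `|rad a b t| <= 2 * e by exact: radial_le.
have rE : rad r s t = rad p q t + rad a b t by rewrite /radial /a /b; ring.
set u := rad p q t in uM rE *; set v := rad a b t in ve rE *.
have uv : 2 * (u * v) + v ^+ 2 <= (8 * M + 4) * e.
  have h1 : u * v <= 2 * M * (2 * e).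
    by apply: le_trans (ler_norm _) _; rewrite normrM ler_pM.
  have h2 : v ^+ 2 <= 2 * e * (2 * e).
    by rewrite -real_normK ?num_real// expr2 ler_pM.
  have h3 : e * e <= e * 1 by rewrite ler_wpM2l.
  lra.
have pe k l : `|k| <= M -> `|l| <= e -> - (2 * (k * l)) <= 2 * M * e.
  move=> kM le_; have : `|k * l| <= M * e by rewrite normrM ler_pM.
  by rewrite ler_norml => /andP[? ?]; lra.
have p1 := pe _ _ pM re; have p2 := pe _ _ qM se.
have a2 := sqr_ge0 (r t - p t); have b2 := sqr_ge0 (s t - q t).
have H : (alpha + 2) * (2 * (u * v) + v ^+ 2) <= (alpha + 2) * ((8 * M + 4) * e).
  by rewrite ler_wpM2l//; lra.
have -> : hess r s t - hess p q t = (alpha + 2) * (2 * (u * v) + v ^+ 2)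
   - (2 * (p t * (r t - p t))) - (r t - p t) ^+ 2 - (2 * (q t * (s t - q t))) - (s t - q t) ^+ 2.
  by rewrite /hessian_density rE -/u; ring.
lra.
Qed.

(** The C^1 inequality is applied to window averages: their derivatives have no larger norm than
    [g0] and [g1], while density and penalty change by a multiple of [e]. *)
Lemma index_form_ge0 p q g0 g1 : continuous p -> continuous q ->
  periodic p (2 * pi) -> periodic q (2 * pi) -> L2 g0 -> L2 g1 -> weak_der p g0 -> weak_der q g1 ->
  (alpha < 1 -> defect p q = 0) ->
  0 <= inner g0 g0 + inner g1 g1 + Int 0 (2 * pi) (hess p q).
Proof.
move=> cp cq pp pq Lg0 Lg1 wp wq dpq; have a0 := alpha0.
have pi0 : 0 < pi :> R := pi_gt0 R.
have [K [K0 K1 HK]] := index_form_C1.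
have [M1 M10 HM1] := continuous_bounded cp (le0_2pi (R := R)).
have [M2 M20 HM2] := continuous_bounded cq (le0_2pi (R := R)).
pose M := M1 + M2.
pose B := (alpha + 2) * (8 * M + 4) + 4 * M.
have M0 : 0 <= M by rewrite /M; lra.
have B0 : 0 <= B by rewrite addr_ge0 ?mulr_ge0//; lra.
pose Z := 2 * pi * B + 32 * K.
have Z0 : 0 <= Z by rewrite addr_ge0 ?mulr_ge0//; lra.
set Q := _ + _ + _.
suff HQ e : 0 < e -> e <= 1 -> 0 <= Q + Z * e.
  rewrite leNgt; apply/negP => Qlt.
  have D0 : 0 < Z + 1 - Q by lra.
  (* For negative [Q] this number lies in []0, 1]] and [Z] times it is below [- Q], a
     contradiction. *)
  have := HQ (- Q / (Z + 1 - Q)).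
  have e0 : 0 < - Q / (Z + 1 - Q) by rewrite divr_gt0//; lra.
  have e1 : - Q / (Z + 1 - Q) <= 1 by rewrite ler_pdivrMr//; lra.
  move=> /(_ e0 e1); rewrite leNgt => /negP; apply.
  rewrite -[ltRHS](addrN Q) ltrD2l mulrA ltr_pdivrMr//.
  have : 0 < Q * Q by rewrite -expr2 exprn_even_gt0//= lt_eqF.
  lra.
move=> e0 e1.
have [d1 d10 H1] := @uniform_shift _ p 0 (2 * pi) e cp e0.
have [d2 d20 H2] := @uniform_shift _ q 0 (2 * pi) e cq e0.
pose h := Num.min d1 d2 / 2.
have m0 : 0 < Num.min d1 d2 by rewrite lt_min d10.
have h0 : 0 < h by rewrite divr_gt0.
have hm : h < Num.min d1 d2 by rewrite /h; lra.
have /andP[h1 h2] : (h < d1) && (h < d2) by rewrite -lt_min.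
have [P dP] := antiderivative cp; have [S dS] := antiderivative cq.
pose r := average P h; pose s := average S h.
have dr x := average_derive h x dP; have ds x := average_derive h x dS.
have cr' : continuous (fun x => (p (x + h) - p x) / h) by continuous_fun.
have cs' : continuous (fun x => (q (x + h) - q x) / h) by continuous_fun.
have pr := average_periodic h dP pp; have ps := average_periodic h dS pq.
have cr := derive_continuous dr; have cs := derive_continuous ds.
have rp t : 0 <= t <= 2 * pi -> `|r t - p t| <= e.
  move=> tI; apply: (average_close dP h0) => k /andP[k0 kh].
  by apply: H1 => //; rewrite ger0_norm//; lra.
have sq t : 0 <= t <= 2 * pi -> `|s t - q t| <= e.
  move=> tI; apply: (average_close dS h0) => k /andP[k0 kh].
  by apply: H2 => //; rewrite ger0_norm//; lra.
have pM t : 0 <= t <= 2 * pi -> `|p t| <= M by move=> /HM1; rewrite /M; lra.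
have qM t : 0 <= t <= 2 * pi -> `|q t| <= M by move=> /HM2; rewrite /M; lra.
have := HK _ _ _ _ dr ds cr' cs' pr ps; rewrite -/r -/s.
have I1 := difference_quotient_L2_le cp pp Lg0 wp h0.
have I2 := difference_quotient_L2_le cq pq Lg1 wq h0.
have cH : continuous (hess p q) by exact: hessian_density_continuous.
have cH' : continuous (hess r s) by exact: hessian_density_continuous.
have I3 : Int 0 (2 * pi) (hess r s) <= Int 0 (2 * pi) (hess p q) + B * e * (2 * pi).
  rewrite -[X in _ * _ * X]subr0 -IntC ?le0_2pi// -IntD; [|continuous_fun..].
  apply: Int_le; [continuous_fun|continuous_fun|] => t tI.
  rewrite addrC -lerBlDr; apply: hessian_density_perturb; rewrite ?pM ?qM ?rp ?sq//.
  by rewrite (ltW e0).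
have I4 : K * defect r s <= K * (32 * e).
  have [a1|a1] := leP 1 alpha; first by rewrite (K1 a1) !mul0r.
  by rewrite ler_wpM2l// (defect_le _ (dpq a1) rp sq)// ltW.
rewrite /Q /Z.
lra.
Qed.

End IndexFormW12.

(** * The potential and the circular solution *)

Section Potential.
Context {R : realType}.
Variables (mass alpha : R).
Hypothesis mass0 : 0 < mass.
Hypothesis alpha0 : 0 <= alpha.
Implicit Types (y m t x : R).

(* The potential and its derivatives as functions of the squared radius. *)
Definition radial_potential y : R :=
  if alpha == 0 then - mass * ln (Num.sqrt y) else mass / Num.sqrt y `^ alpha.

(** The potential is [mass * y^(- alpha / 2)], or [- (mass / 2) * ln y] in the logarithmic case;
    with this constant one formula covers both derivatives. *)
Definition kappa : R := if alpha == 0 then mass / 2 else alpha * mass / 2.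
Definition radial_potential1 y : R := - kappa * y `^ (- alpha / 2 - 1).
Definition radial_potential2 y : R := kappa * (alpha / 2 + 1) * y `^ (- alpha / 2 - 2).

Lemma enorm_sqr (x : 'rV[R]_2) : enorm x ^+ 2 = x 0 0 ^+ 2 + x 0 1 ^+ 2.
Proof.
rewrite /enorm sqr_sqrtr ?sumr_ge0// => [|i _]; last exact: sqr_ge0.
by rewrite !big_ord_recl big_ord0 addr0; congr (x _ _ ^+ 2 + x _ _ ^+ 2); apply/val_inj.
Qed.

Lemma kepler_potentialE (x : 'rV[R]_2) :
  kepler_potential mass alpha x = radial_potential (x 0 0 ^+ 2 + x 0 1 ^+ 2).
Proof. by rewrite -enorm_sqr /radial_potential sqrtr_sqr ger0_norm// sqrtr_ge0. Qed.

Lemma radial_potential_derive y : 0 < y -> is_derive y 1 radial_potential (radial_potential1 y).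
Proof.
move=> y0.
have [al0|aln0] := eqVneq alpha 0.
  have dl : is_derive y 1 (fun z => (- mass / 2) * ln z) (radial_potential1 y).
    have ln' : is_derive y 1 (@ln R) (y^-1) by exact: is_derive1_ln.
    have H := derive_fun_mul (derive_fun_cst (- mass / 2) y) ln'; apply: is_deriveR_eq H _; cbn beta.
    rewrite /radial_potential1 /kappa al0 eqxx (_ : - 0 / 2 - 1 = -1); last by ring.
    by rewrite powR_inv1 ?ltW//; ring.
  apply: near_eq_is_derive dl; near=> z.
  have z0 : 0 < z by near: z; exact: lt_nbhsr.
  by rewrite /radial_potential al0 eqxx -powR12_sqrt ?ltW// ln_powR; field.
have dp : is_derive y 1 (fun z => mass * z `^ (- alpha / 2)) (radial_potential1 y).
  have pw := is_derive1_powR (- alpha / 2) y0.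
  have H := derive_fun_mul (derive_fun_cst mass y) pw; apply: is_deriveR_eq H _; cbn beta.
  by rewrite /radial_potential1 /kappa (negbTE aln0); ring.
apply: near_eq_is_derive dp; near=> z.
have z0 : 0 < z by near: z; exact: lt_nbhsr.
rewrite /radial_potential (negbTE aln0) -powR12_sqrt ?ltW// -powRrM -powRN.
by congr (_ * _ `^ _); field.
Unshelve. all: by end_near. Qed.

Lemma radial_potential1_derive y : 0 < y -> is_derive y 1 radial_potential1 (radial_potential2 y).
Proof.
move=> y0; have pw := is_derive1_powR (- alpha / 2 - 1) y0.
have H := derive_fun_mul (derive_fun_cst (- kappa) y) pw; apply: is_deriveR_eq H _; cbn beta.
rewrite /radial_potential2 (_ : - alpha / 2 - 1 - 1 = - alpha / 2 - 2); last by ring.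
by ring.
Qed.

Lemma kappa_ge0 : 0 <= kappa.
Proof. by rewrite /kappa; case: ifP => _; rewrite ?divr_ge0// ?mulr_ge0// ltW. Qed.

Lemma powR_neg_le k m y : 0 <= k -> 0 < m -> m <= y -> y `^ (- k) <= m `^ (- k).
Proof.
move=> k0 m0 my; have y0 : 0 < y by exact: lt_le_trans my.
rewrite !powRN lef_pV2 ?posrE ?powR_gt0//.
by apply: ge0_ler_powR => //; rewrite nnegrE ltW.
Qed.

Lemma radial_potential1_bound m : 0 < m -> exists2 B, 0 <= B & forall y, m <= y -> `|radial_potential1 y| <= B.
Proof.
move=> m0; exists (kappa * m `^ (- (alpha / 2 + 1))); first by rewrite mulr_ge0 ?kappa_ge0// powR_ge0.
move=> y my; rewrite /radial_potential1 mulNr normrN ger0_norm; last by rewrite mulr_ge0 ?kappa_ge0// powR_ge0.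
rewrite (_ : - alpha / 2 - 1 = - (alpha / 2 + 1)); last by ring.
by rewrite ler_wpM2l ?kappa_ge0// powR_neg_le// addr_ge0// divr_ge0.
Qed.

Lemma radial_potential2_bound m : 0 < m -> exists2 B, 0 <= B & forall y, m <= y -> `|radial_potential2 y| <= B.
Proof.
have a1 : 0 <= alpha / 2 + 1 by rewrite addr_ge0// divr_ge0.
have a2 : 0 <= alpha / 2 + 2 by rewrite addr_ge0// divr_ge0.
move=> m0; exists (kappa * (alpha / 2 + 1) * m `^ (- (alpha / 2 + 2))).
  by rewrite !mulr_ge0 ?kappa_ge0// powR_ge0.
move=> y my; rewrite /radial_potential2 ger0_norm; last by rewrite !mulr_ge0 ?kappa_ge0// powR_ge0.
rewrite (_ : - alpha / 2 - 2 = - (alpha / 2 + 2)); last by ring.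
by rewrite ler_wpM2l ?mulr_ge0 ?kappa_ge0// powR_neg_le.
Qed.

(** Homogeneity reduces the second derivative at the orbit to the first, whose value the equation of
    motion fixes. *)
Lemma radial_potential2E y : 0 < y -> radial_potential2 y * y = - (alpha / 2 + 1) * radial_potential1 y.
Proof.
move=> y0; rewrite /radial_potential2 /radial_potential1.
have -> : y `^ (- alpha / 2 - 1) = y `^ (- alpha / 2 - 2) * y.
  rewrite -[X in _ = _ * X]powRr1 ?ltW// -powRD; last by rewrite (gt_eqF y0) implybT.
  by congr (_ `^ _); ring.
by ring.
Qed.

End Potential.

Lemma derive_along_line (R : realType) (V : normedModType R) (f : V -> R) (x v : V) :
  'D_v f x = 'D_1 (fun h : R => f (h *: v + x)) 0.
Proof.
rewrite /derive; set g1 := (fun h => _); set g2 := (fun h => _).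
suff -> : g1 = g2 by [].
by rewrite funeqE /g1 /g2 => h /=; rewrite addr0 scale0r add0r [_%:A]mulr1.
Qed.

(** * The radius selected by the equation of motion *)

Section CircularMotion.
Context {R : realType}.
Variables (mass alpha a w th : R) (gamma : R -> 'rV[R]_2).
Hypothesis mass0 : 0 < mass.
Hypothesis alpha0 : 0 <= alpha.
Hypothesis a0 : 0 < a.
Hypothesis w2 : w ^+ 2 = 1.
Hypothesis gammaE : forall t, gamma t = \row_i (if i == 0 then a * cos (w * t + th)
                            else a * sin (w * t + th)).

Lemma derive1_row2 (f : R -> 'rV[R]_2) (f0 f1 : R -> R) :
  (forall t : R, is_derive t 1 (fun s => f s 0 0) (f0 t)) ->
  (forall t : R, is_derive t 1 (fun s => f s 0 1) (f1 t)) ->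
  derive1 f = fun t => \row_i (if i == 0 then f0 t else f1 t).
Proof.
move=> d0 d1; apply/funext => t; rewrite derive1E.
have dj (j : 'I_2) : is_derive t 1 (fun s => f s 0 j) (if j == 0 then f0 t else f1 t).
  case: j => -[|[|//]] hj /=.
    by rewrite (_ : Ordinal hj = 0) ?eqxx//; exact: val_inj.
  by rewrite (_ : Ordinal hj = 1)//; exact: val_inj.
rewrite derive_mx; last by apply/derivable_mxP => i j; rewrite (ord1 i); case: (dj j).
by apply/rowP => j; rewrite !mxE; case: (dj j).
Qed.

Lemma equation_of_motion_radius : solves_motion (kepler_potential mass alpha) gamma ->
  radial_potential1 mass alpha (a ^+ 2) = - 2^-1.
Proof.
(* At this time the phase is zero because [w ^ 2 = 1]: the body is on the first axis and the first
   component carries the whole equation. *)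
move=> /(_ (- th * w)) /(congr1 (fun x : 'rV[R]_2 => x 0 0)).
have ph : w * (- th * w) + th = 0.
  by rewrite (_ : w * (- th * w) + th = th * (1 - w ^+ 2)); [rewrite w2; ring|ring].
rewrite derive1nS derive1n1.
have g0 t : gamma t 0 0 = a * cos (w * t + th) by rewrite gammaE mxE.
have g1 t : gamma t 0 1 = a * sin (w * t + th) by rewrite gammaE mxE.
pose v t : 'rV[R]_2 := \row_i (if i == 0 then - a * w * sin (w * t + th) else a * w * cos (w * t + th)).
have gammav : derive1 gamma = v.
  apply: derive1_row2 => t.
  - by under eq_fun do rewrite g0; derive_fun; ring.
  - by under eq_fun do rewrite g1; derive_fun; ring.
have v' : derive1 v = fun t => \row_i (if i == 0 then - a * w ^+ 2 * cos (w * t + th)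
                                       else - a * w ^+ 2 * sin (w * t + th)).
  apply: derive1_row2 => t.
  - by under eq_fun do rewrite mxE /=; derive_fun; ring.
  - by under eq_fun do rewrite mxE /=; derive_fun; ring.
rewrite gammav v'.
rewrite !mxE/= ph cos0 w2 !mulr1 => E.
pose G h := radial_potential mass alpha ((h + a) ^+ 2).
have EG : (fun h : R => kepler_potential mass alpha (h *: delta_mx 0 0 + gamma (- th * w))) = G.
  apply/funext => h.
  rewrite kepler_potentialE !mxE /= !g0 !g1 ph cos0 sin0 /G; congr radial_potential.
  by ring.
have dG : is_derive (0 : R) 1 G (radial_potential1 mass alpha (a ^+ 2) * (2 * a)).
  have a2 : 0 < (0 + a) ^+ 2 by rewrite add0r exprn_gt0.
  have dF := radial_potential_derive mass alpha a2.
  have dsq : is_derive (0 : R) 1 (fun h : R => (h + a) ^+ 2) (2 * a) by derive_fun; ring.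
  by have := @derive_fun_comp R _ (fun h => (h + a) ^+ 2) 0 _ _ dF dsq; rewrite add0r.
move: E; rewrite derive_along_line EG derive_val => E.
have an0 : 2 * a != 0 by rewrite mulf_neq0 ?gt_eqF.
by apply: (mulIf an0); rewrite -E; field.
Qed.
End CircularMotion.

(** * Differentiation of the potential energy *)

Section CircleIntegrals.
Context {R : realType}.
Local Notation mu := (@lebesgue_measure R).
Local Notation C := (@circle R).
Implicit Types (r t x : R).

Lemma continuous_on_circle_integrable (f : R -> R) :
  (forall t, 0 <= t <= 2 * pi -> {for t, continuous f}) -> mu.-integrable C (EFin \o f).
Proof.
move=> cf; rewrite circleE; apply: continuous_compact_integrable.
  exact: segment_compact.
apply: continuous_in_subspaceT => t; rewrite inE/= in_itv/=; exact: cf.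
Qed.

Lemma is_derive_under_circle (f f' : R -> R -> R) (dl B : R) :
  (forall r, `|r| < dl -> mu.-integrable C (EFin \o f r)) ->
  (forall r t : R, `|r| < dl -> C t -> is_derive r 1 (f^~ t) (f' r t)) ->
  0 <= B -> (forall r t, `|r| < dl -> C t -> `|f' r t| <= B) ->
  forall r, `|r| < dl ->
    is_derive r 1 (fun s => \int[mu]_(t in C) f s t) (\int[mu]_(t in C) f' r t).
Proof.
move=> intf df B0 bf r rdl.
have I x : `]- dl, dl[%classic x -> `|x| < dl by rewrite /= in_itv/= ltr_norml.
have Ir : `]- dl, dl[%classic r by rewrite /= in_itv/= -ltr_norml.
have h1 x : `]- dl, dl[%classic x -> mu.-integrable C (EFin \o f x) by move=> /I; exact: intf.
have h2 x y : `]- dl, dl[%classic x -> C y -> derivable (f^~ y) x 1.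
  by move=> /I xI Cy; case: (df x y xI Cy).
have h3 : mu.-integrable C (EFin \o (fun _ : R => B)) by apply: circle_integrable; continuous_fun.
have p1 x y : `|x| < dl -> C y -> partial1of2 f x y = f' x y.
  by move=> xI Cy; rewrite partial1of2E; case: (df x y xI Cy).
have h4 x y : `]- dl, dl[%classic x -> C y -> `|partial1of2 f x y| <= B.
  by move=> /I xI Cy; rewrite p1//; exact: bf.
split.
  exact: (derivable_under_integral (@measurable_circle R) Ir h1 h2 (fun=> B0) h3 h4).
rewrite -derive1E (differentiation_under_integral (@measurable_circle R) Ir h1 h2 (fun=> B0) h3 h4).
by apply: eq_Rintegral => t; rewrite inE => Ct; rewrite p1.
Qed.

End CircleIntegrals.

Section PotentialEnergy.
Context {R : realType}.
Variables (mass alpha a w th : R).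
Hypothesis mass0 : 0 < mass.
Hypothesis alpha0 : 0 <= alpha.
Hypothesis a0 : 0 < a.
Hypothesis w2 : w ^+ 2 = 1.
Hypothesis radius : radial_potential1 mass alpha (a ^+ 2) = - 2^-1.
Local Notation mu := (@lebesgue_measure R).
Local Notation C := (@circle R).
Variables (p q : R -> R).
Hypothesis (cp : continuous p) (cq : continuous q).
Local Notation u := (radial w th p q).
Local Notation Phi := (radial_potential mass alpha).
Local Notation Phi1 := (radial_potential1 mass alpha).
Local Notation Phi2 := (radial_potential2 mass alpha).
Local Notation nsq := (fun t => p t ^+ 2 + q t ^+ 2).

(* rho r t = |gamma t + r xi t|^2 for the variation xi = (p, q). *)
Definition rho r t := a ^+ 2 + 2 * r * a * u t + r ^+ 2 * (p t ^+ 2 + q t ^+ 2).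
Definition rho' r t := 2 * a * u t + 2 * r * (p t ^+ 2 + q t ^+ 2).
Definition denergy r t := Phi1 (rho r t) * rho' r t.
Definition d2energy r t := Phi2 (rho r t) * rho' r t ^+ 2 + Phi1 (rho r t) * (2 * (p t ^+ 2 + q t ^+ 2)).

Let cu : continuous u := radial_continuous cp cq.

Lemma rho_continuous r : continuous (rho r).
Proof. by have cu' := cu; rewrite /rho; continuous_fun. Qed.

Lemma rho'_continuous r : continuous (rho' r).
Proof. by have cu' := cu; rewrite /rho'; continuous_fun. Qed.

Lemma rho_derive (r t : R) : is_derive r 1 (rho^~ t) (rho' r t).
Proof. by rewrite /rho /rho'; derive_fun; ring. Qed.

(** For small [r] the varied loop stays away from the origin, so the derivatives of the potential
    along it have constant bounds, as differentiation under the integral requires. *)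
Lemma rho_bounds : exists dl B : R, [/\ 0 < dl, 0 <= B,
  forall r t, `|r| < dl -> C t -> a ^+ 2 / 2 <= rho r t,
  forall r t, `|r| < dl -> C t -> `|rho' r t| <= B &
  forall t, C t -> `|2 * (p t ^+ 2 + q t ^+ 2)| <= B].
Proof.
have a0' := a0.
have [M1 M10 HM1] := continuous_bounded cp (le0_2pi (R := R)).
have [M2 M20 HM2] := continuous_bounded cq (le0_2pi (R := R)).
pose M := M1 + M2.
have M0 : 0 <= M by rewrite /M; lra.
have CI t : C t -> 0 <= t <= 2 * pi by rewrite circleE/= in_itv.
have pM t : C t -> `|p t| <= M by move=> /CI /HM1; rewrite /M; lra.
have qM t : C t -> `|q t| <= M by move=> /CI /HM2; rewrite /M; lra.
have uM t : C t -> `|u t| <= 2 * M by move=> Ct; apply: radial_le; [exact: pM|exact: qM].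
have sqM x : `|x| <= M -> x ^+ 2 <= M * M.
  by move=> xM; rewrite -real_normK ?num_real// expr2 ler_pM.
have N0 t : 0 <= p t ^+ 2 + q t ^+ 2 by rewrite addr_ge0 ?sqr_ge0.
have NM t : C t -> p t ^+ 2 + q t ^+ 2 <= 2 * (M * M).
  by move=> Ct; have := sqM _ (pM _ Ct); have := sqM _ (qM _ Ct); lra.
(* Since [|u| <= 2 * M], the second bound forces [2 r a u >= - a^2 / 2]; the bound [1] serves the
   estimate of [rho']. *)
pose dl := Num.min 1 (a / (8 * (M + 1))).
have M8 : 0 < 8 * (M + 1) by lra.
have dl0 : 0 < dl by rewrite lt_min ltr01 divr_gt0.
exists dl, (4 * a * M + 4 * (M * M)).
have MM : 0 <= M * M by rewrite mulr_ge0.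
have aM : 0 <= a * M by rewrite mulr_ge0// ltW.
split => //.
- by lra.
- move=> r t; rewrite lt_min => /andP[_]; rewrite ltr_pdivlMr// => rM Ct.
  have ru : `|r * u t| <= `|r| * (2 * M) by rewrite normrM ler_wpM2l// uM.
  have r0 := normr_ge0 r.
  have h : - (a / 4) <= r * u t.
    by move: ru; rewrite ler_norml => /andP[h _]; lra.
  have ha : a * (- (a / 4)) <= a * (r * u t) by rewrite ler_wpM2l// ltW.
  have : 0 <= r ^+ 2 * (p t ^+ 2 + q t ^+ 2) by rewrite mulr_ge0 ?sqr_ge0.
  rewrite /rho; move: ha; rewrite [a ^+ 2]expr2; lra.
- move=> r t; rewrite lt_min => /andP[r1 _] Ct.
  rewrite /rho' (le_trans (ler_normD _ _))// !normrM (gtr0_norm a0) (ger0_norm (N0 t)) normr_nat.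
  have h1 : a * `|u t| <= a * (2 * M) by rewrite ler_wpM2l ?uM// ltW.
  have h2 : `|r| * (p t ^+ 2 + q t ^+ 2) <= 1 * (2 * (M * M)) by rewrite ler_pM// ?NM// ltW.
  lra.
- move=> t Ct; rewrite normrM normr_nat (ger0_norm (N0 t)).
  have := NM t Ct; lra.
Qed.

Let m0 : 0 < a ^+ 2 / 2. Proof. by rewrite divr_gt0// exprn_gt0. Qed.

Lemma energy_derivatives : exists2 dl : R, 0 < dl &
  [/\ forall r, `|r| < dl -> mu.-integrable C (EFin \o (fun t => Phi (rho r t))),
    forall r : R, `|r| < dl -> is_derive r 1 (fun s => \int[mu]_(t in C) Phi (rho s t))
      (\int[mu]_(t in C) denergy r t) &
    is_derive (0 : R) 1 (fun s => \int[mu]_(t in C) denergy s t)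
      (\int[mu]_(t in C) d2energy 0 t)].
Proof.
have [dl [B [dl0 B0 rl rB nB]]] := rho_bounds.
have [B1 B10 HB1] := radial_potential1_bound mass0 alpha0 m0.
have [B2 B20 HB2] := radial_potential2_bound mass0 alpha0 m0.
have rp r t : `|r| < dl -> C t -> 0 < rho r t.
  by move=> h Ct; apply: lt_le_trans (rl _ _ h Ct); exact: m0.
have CI t : 0 <= t <= 2 * pi -> C t by rewrite circleE/= in_itv.
have cPhi r t : `|r| < dl -> 0 <= t <= 2 * pi -> {for t, continuous (fun t => Phi (rho r t))}.
  move=> h /CI Ct; apply: continuous_comp; first exact: rho_continuous.
  apply: differentiable_continuous; apply/derivable1_diffP.
  by have [] := radial_potential_derive mass alpha (rp _ _ h Ct).
have cPhi1 r t : `|r| < dl -> 0 <= t <= 2 * pi -> {for t, continuous (fun t => Phi1 (rho r t))}.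
  move=> h /CI Ct; apply: continuous_comp; first exact: rho_continuous.
  apply: differentiable_continuous; apply/derivable1_diffP.
  by have [] := radial_potential1_derive mass alpha (rp _ _ h Ct).
have i0 r : `|r| < dl -> mu.-integrable C (EFin \o (fun t => Phi (rho r t))).
  by move=> h; apply: continuous_on_circle_integrable => t tI; exact: cPhi.
have i1 r : `|r| < dl -> mu.-integrable C (EFin \o denergy r).
  move=> h; apply: continuous_on_circle_integrable => t tI.
  apply: continuousM; [exact: cPhi1|exact: rho'_continuous].
exists dl => //; split => //.
- apply: (@is_derive_under_circle _ (fun r t => Phi (rho r t)) denergy dl (B1 * B)) => //.
  + move=> r t h Ct; have dP := radial_potential_derive mass alpha (rp _ _ h Ct).
    exact: (@derive_fun_comp R _ (rho^~ t) r _ _ dP (rho_derive r t)).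
  + by rewrite mulr_ge0.
  + by move=> r t h Ct; rewrite normrM ler_pM ?HB1 ?rl ?rB.
- apply: (@is_derive_under_circle _ denergy d2energy dl (B2 * (B * B) + B1 * B)) => //.
  + move=> r t h Ct; have dP := radial_potential1_derive mass alpha (rp _ _ h Ct).
    have d1 := @derive_fun_comp R _ (rho^~ t) r _ _ dP (rho_derive r t).
    have d2 : is_derive r 1 (rho'^~ t) (2 * (p t ^+ 2 + q t ^+ 2)) by rewrite /rho'; derive_fun; ring.
    have d3 := derive_fun_mul d1 d2.
    by apply: is_deriveR_eq d3 _; rewrite /d2energy; ring.
  + by rewrite addr_ge0// !mulr_ge0.
  + move=> r t h Ct; rewrite (le_trans (ler_normD _ _))// lerD//.
      rewrite normrM normrX expr2 ler_pM// ?HB2 ?rl//.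
      by rewrite ler_pM ?rB.
    by rewrite normrM ler_pM ?HB1 ?rl ?nB.
  + by rewrite normr0.
Qed.

Lemma d2energy0 t : d2energy 0 t = hessian_density alpha w th p q t.
Proof.
have a20 : 0 < a ^+ 2 by rewrite exprn_gt0.
have E := radial_potential2E mass alpha a20.
rewrite /d2energy /rho /rho' /hessian_density.
rewrite (_ : a ^+ 2 + 2 * 0 * a * u t + 0 ^+ 2 * (p t ^+ 2 + q t ^+ 2) = a ^+ 2); last by ring.
rewrite (_ : 2 * a * u t + 2 * 0 * (p t ^+ 2 + q t ^+ 2) = 2 * a * u t); last by ring.
rewrite (_ : Phi2 (a ^+ 2) * (2 * a * u t) ^+ 2 = (Phi2 (a ^+ 2) * a ^+ 2) * (4 * u t ^+ 2)); last by ring.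
by rewrite E radius; field.
Qed.

End PotentialEnergy.

(** * The second variation *)

Section SecondVariation.
Context {R : realType}.
Variables (mass alpha a w th : R) (gamma : R -> 'rV[R]_2).
Hypothesis mass0 : 0 < mass.
Hypothesis alpha0 : 0 <= alpha.
Hypothesis a0 : 0 < a.
Hypothesis w2 : w ^+ 2 = 1.
Hypothesis radius : radial_potential1 mass alpha (a ^+ 2) = - 2^-1.
Hypothesis gammaE : forall t, gamma t = \row_i (if i == 0 then a * cos (w * t + th)
                            else a * sin (w * t + th)).
Local Notation mu := (@lebesgue_measure R).
Local Notation C := (@circle R).
Local Notation U := (kepler_potential mass alpha).
Implicit Types (x xi : R -> 'rV[R]_2) (h p q : R -> R) (r s t : R).

Lemma ord2E (i : 'I_2) : i = 0 \/ i = 1.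
Proof. by case: i => -[|[|//]] hi; [left|right]; exact: val_inj. Qed.

Lemma L2_weak_derivativeP x v : L2_weak_derivative x v <->
  forall i : 'I_2, L2 (fun t => v t 0 i) /\ weak_der (fun t => x t 0 i) (fun t => v t 0 i).
Proof.
split; first by move=> [sv wv] i; split; [exact: sv i|exact: wv i].
by move=> H; split => i; [exact: (H i).1|exact: (H i).2].
Qed.

Lemma velocityP x h0 h1 : L2 h0 -> L2 h1 ->
  weak_der (fun t => x t 0 0) h0 -> weak_der (fun t => x t 0 1) h1 ->
  L2_weak_derivative x (velocity x).
Proof.
(* [velocity] falls back on [0] when there is no weak derivative; [h0] and [h1] supply one, so the
   chosen value is genuine. *)
move=> L0 L1 w0 w1; apply: (xgetPex (fun=> 0)).
exists (fun t => \row_i (if i == 0 then h0 t else h1 t)).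
apply/L2_weak_derivativeP => i; case: (ord2E i) => ->.
  by under eq_fun do rewrite mxE /=.
by under eq_fun do rewrite mxE /=.
Qed.

(** The chosen velocity may differ from [h0], [h1] on a null set, but only its norm enters the
    action. *)
Lemma actionE x h0 h1 : L2 h0 -> L2 h1 ->
  weak_der (fun t => x t 0 0) h0 -> weak_der (fun t => x t 0 1) h1 ->
  mu.-integrable C (EFin \o (fun t => U (x t))) ->
  action U x = 2^-1 * (inner h0 h0 + inner h1 h1) + \int[mu]_(t in C) U (x t).
Proof.
move=> L0 L1 w0 w1 iU.
have /L2_weak_derivativeP vP := velocityP L0 L1 w0 w1.
have [Lv0 wv0] := vP 0; have [Lv1 wv1] := vP 1.
rewrite -(weak_derivative_norm_unique Lv0 L0 wv0 w0) -(weak_derivative_norm_unique Lv1 L1 wv1 w1).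
set v := velocity x in Lv0 Lv1 wv0 wv1 *.
have mC := @measurable_circle R.
have i0 := L2_mul Lv0 Lv0; have i1 := L2_mul Lv1 Lv1.
have i01 : mu.-integrable C (EFin \o (fun t => v t 0 0 * v t 0 0 + v t 0 1 * v t 0 1)).
  by have := integrableD mC i0 i1.
have i2 : mu.-integrable C (EFin \o (fun t => 2^-1 * (v t 0 0 * v t 0 0 + v t 0 1 * v t 0 1))).
  by have := integrableZl mC 2^-1 i01.
rewrite /inner -RintegralD// -RintegralZl// -RintegralD//.
by apply: eq_Rintegral => t _; rewrite /lagrangian enorm_sqr !expr2.
Qed.

Section Variation.
Variables (xi : R -> 'rV[R]_2) (g0 g1 : R -> R).
Let p t : R := xi t 0 0.
Let q t : R := xi t 0 1.
Hypothesis (cp : continuous p) (cq : continuous q).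
Hypothesis (Lg0 : L2 g0) (Lg1 : L2 g1) (wp : weak_der p g0) (wq : weak_der q g1).

Let c0 t := a * cos (w * t + th).
Let c1 t := a * sin (w * t + th).
Let c0' t : R := - a * w * sin (w * t + th).
Let c1' t := a * w * cos (w * t + th).

(** Along the line the kinetic part is a quadratic polynomial in [s], so only the potential part is
    differentiated under the integral. The statement is local because the line may meet the origin
    for larger [s]. *)
Lemma action_variation : exists2 dl : R, 0 < dl & exists f' : R -> R,
  (forall r, `|r| < dl -> is_derive r 1 (fun s => action U (gamma + s *: xi)) (f' r)) /\
  is_derive (0 : R) 1 f' (inner g0 g0 + inner g1 g1 + Int 0 (2 * pi) (hessian_density alpha w th p q)).
Proof.
have [dl dl0 [iE dE d2E]] := energy_derivatives w th mass0 alpha0 a0 cp cq.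
have dc0 t : is_derive t 1 c0 (c0' t) by rewrite /c0 /c0'; derive_fun; ring.
have dc1 t : is_derive t 1 c1 (c1' t) by rewrite /c1 /c1'; derive_fun; ring.
have cc0' : continuous c0' by rewrite /c0'; continuous_fun.
have cc1' : continuous c1' by rewrite /c1'; continuous_fun.
have cc0 := derive_continuous dc0; have cc1 := derive_continuous dc1.
have pc0 : periodic c0 (2 * pi) by move=> t; rewrite /c0 (cos_phase_periodic th w2).
have pc1 : periodic c1 (2 * pi) by move=> t; rewrite /c1 (sin_phase_periodic th w2).
have Lc0 := L2_continuous cc0'; have Lc1 := L2_continuous cc1'.
have wc0 := weak_der_C1 dc0 cc0' pc0; have wc1 := weak_der_C1 dc1 cc1' pc1.
have x0 r t : (gamma + r *: xi) t 0 0 = c0 t + r * p t.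
  by rewrite /= fctE gammaE !mxE.
have x1 r t : (gamma + r *: xi) t 0 1 = c1 t + r * q t.
  by rewrite /= fctE gammaE !mxE.
have UE r t : U ((gamma + r *: xi) t) = radial_potential mass alpha (rho a w th p q r t).
  rewrite kepler_potentialE x0 x1; congr radial_potential.
  rewrite /rho /radial /c0 /c1; have := cos2Dsin2 (w * t + th).
  set cs := cos _; set sn := sin _ => CS.
  have {}CS : cs ^+ 2 = 1 - sn ^+ 2 by lra.
  by ring: CS.
have Lrg0 r : L2 (fun t => r * g0 t) by exact: L2_scale.
have Lrg1 r : L2 (fun t => r * g1 t) by exact: L2_scale.
pose A0 := inner c0' c0' + inner c1' c1'.
pose A1 := inner c0' g0 + inner c1' g1.
pose A2 := inner g0 g0 + inner g1 g1.
pose W r := \int[mu]_(t in C) radial_potential mass alpha (rho a w th p q r t).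
have AE r : `|r| < dl -> action U (gamma + r *: xi) = 2^-1 * (A0 + 2 * r * A1 + r ^+ 2 * A2) + W r.
  move=> rdl.
  have EW : \int[mu]_(t in C) U ((gamma + r *: xi) t) = W r.
    by apply: eq_Rintegral => t _; rewrite UE.
  have EK : inner (fun t => c0' t + r * g0 t) (fun t => c0' t + r * g0 t) +
      inner (fun t => c1' t + r * g1 t) (fun t => c1' t + r * g1 t) = A0 + 2 * r * A1 + r ^+ 2 * A2.
    rewrite (inner_line r Lc0 Lg0).
    rewrite (inner_line r Lc1 Lg1).
    rewrite /A0 /A1 /A2.
    by ring.
  have X0 : (fun t => (gamma + r *: xi) t 0 0) = (fun t => c0 t + r * p t).
    by apply/funext => t; exact: x0.
  have X1 : (fun t => (gamma + r *: xi) t 0 1) = (fun t => c1 t + r * q t).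
    by apply/funext => t; exact: x1.
  have XU : (fun t => U ((gamma + r *: xi) t)) = (fun t => radial_potential mass alpha (rho a w th p q r t)).
    by apply/funext => t; exact: UE.
  have crp : continuous (fun t => r * p t) by continuous_fun.
  have crq : continuous (fun t => r * q t) by continuous_fun.
  have W0 := weak_der_add cc0 crp Lc0 (Lrg0 r) wc0 (weak_der_scale r cp Lg0 wp).
  have W1 := weak_der_add cc1 crq Lc1 (Lrg1 r) wc1 (weak_der_scale r cq Lg1 wq).
  rewrite -X0 in W0; rewrite -X1 in W1.
  have iU := iE r rdl; rewrite -XU in iU.
  have := actionE (L2_add Lc0 (Lrg0 r)) (L2_add Lc1 (Lrg1 r)) W0 W1 iU.
  by rewrite EW EK.
exists dl => //.
exists (fun r => A1 + r * A2 + \int[mu]_(t in C) denergy mass alpha a w th p q r t); split.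
  move=> r rdl; have dW := dE _ rdl.
  have dk : is_derive r 1 (fun r => 2^-1 * (A0 + 2 * r * A1 + r ^+ 2 * A2)) (A1 + r * A2).
    by derive_fun; field.
  have := derive_fun_add dk dW; apply: near_eq_is_derive.
  near=> s; rewrite AE//; near: s.
  apply: (cvgr_lt `|r|) => //; exact: norm_continuous.
have dk : is_derive (0 : R) 1 (fun r => A1 + r * A2) A2 by derive_fun; ring.
have HE : \int[mu]_(t in C) d2energy mass alpha a w th p q 0 t =
    Int 0 (2 * pi) (hessian_density alpha w th p q).
  by rewrite circleE; apply: eq_Rintegral => t _; exact: d2energy0.
by rewrite -HE; exact: derive_fun_add dk d2E.
Unshelve. all: by end_near. Qed.

Lemma second_variationE : second_variation U gamma xi xi =
  inner g0 g0 + inner g1 g1 + Int 0 (2 * pi) (hessian_density alpha w th p q).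
Proof.
have [dl dl0 [f' [df d2f]]] := action_variation.
rewrite /second_variation derive1E -[RHS](@derive_val _ _ _ _ _ _ _ d2f).
apply: near_eq_derive; near=> s.
have sdl : `|s| < dl.
  near: s; apply: (cvgr_lt `|0 : R|); first exact: norm_continuous.
  by rewrite normr0.
rewrite derive1E.
(* On the diagonal both derivatives run along one line, so the inner one is [f'] at [s]. *)
have -> : (fun t => action U (gamma + s *: xi + t *: xi)) =
          (fun t => action U (gamma + (t + s) *: xi)).
  by apply/funext => t; rewrite scalerDl addrAC addrA.
have ds : is_derive (0 + s) 1 (fun r => action U (gamma + r *: xi)) (f' (0 + s)).
  by apply: df; rewrite add0r.
have dsh : is_derive (0 : R) 1 (fun t : R => t + s) 1 by derive_fun; ring.
have dd := @derive_fun_comp R _ (fun t : R => t + s) 0 _ _ ds dsh.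
by rewrite (@derive_val _ _ _ _ _ _ _ dd) add0r mulr1.
Unshelve. all: by end_near. Qed.

End Variation.
End SecondVariation.

(** * The index *)

Section MorseIndex.
Context {R : realType}.
Variables (mass alpha a w th : R) (gamma : R -> 'rV[R]_2).
Hypothesis mass0 : 0 < mass.
Hypothesis alpha0 : 0 <= alpha.
Hypothesis a0 : 0 < a.
Hypothesis w2 : w ^+ 2 = 1.
Hypothesis radius : radial_potential1 mass alpha (a ^+ 2) = - 2^-1.
Hypothesis gammaE : forall t, gamma t = \row_i (if i == 0 then a * cos (w * t + th)
                            else a * sin (w * t + th)).
Local Notation U := (kepler_potential mass alpha).
Local Notation loop := (R -> 'rV[R]_2).
Implicit Types (xi : loop) (r s t : R).

Definition coord_fun xi (i : 'I_2) t : R := xi t 0 i.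
Definition radial_part xi t := radial w th (coord_fun xi 0) (coord_fun xi 1) t.

Lemma W12_coord xi (i : 'I_2) : W12 xi ->
  continuous (coord_fun xi i) /\ periodic (coord_fun xi i) (2 * pi).
Proof.
move=> [pxi cxi _]; split.
  move=> t; apply: (@continuous_comp _ _ _ xi (fun M : 'rV[R]_2 => M 0 i)); first exact: cxi.
  exact: coord_continuous.
by move=> t; rewrite /coord_fun (mulr_natl pi 2) pxi.
Qed.

Lemma second_variation_ge0 xi : W12 xi ->
  (alpha < 1 -> radial_part xi pi - radial_part xi 0 = 0 /\
     radial_part xi (pi / 2 + pi) - radial_part xi (pi / 2) = 0) ->
  0 <= second_variation U gamma xi xi.
Proof.
move=> Wxi cons; have [c0 p0] := W12_coord 0 Wxi; have [c1 p1] := W12_coord 1 Wxi.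
have [_ _ [g /L2_weak_derivativeP gP]] := Wxi.
have [L0 wd0] := gP 0; have [L1 wd1] := gP 1.
rewrite (second_variationE mass0 alpha0 a0 w2 radius gammaE c0 c1 L0 L1 wd0 wd1).
apply: (index_form_ge0 w2 alpha0 c0 c1 p0 p1 L0 L1 wd0 wd1) => a1.
have [z1 z2] := cons a1.
by rewrite /defect -/(radial_part xi pi) z1 z2 expr0n addr0.
Qed.

Lemma subspace_sum (V : set loop) n (e : 'I_n -> loop) (c : 'I_n -> R) :
  linear_subspace V -> (forall i, V (e i)) -> V (\sum_i c i *: e i).
Proof.
move=> [V0 VL] Ve; apply: (big_ind V) => //.
- by move=> x y Vx Vy; have := VL 1 _ _ Vx Vy; rewrite scale1r.
- by move=> i _; have := VL (c i) _ _ (Ve i) V0; rewrite addr0.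
Qed.

Lemma radial_part_sum n (e : 'I_n -> loop) (c : 'I_n -> R) t :
  radial_part (\sum_i c i *: e i) t = \sum_i c i * radial_part (e i) t.
Proof.
have E j : coord_fun (\sum_i c i *: e i) j t = \sum_i c i * coord_fun (e i) j t.
  by rewrite /coord_fun fct_sumE summxE; apply: eq_bigr => i _; rewrite mxE.
rewrite /radial_part /radial !E !mulr_suml -big_split/=.
by apply: eq_bigr => i _; ring.
Qed.

(** If [n] is too large, some nonzero combination of the basis satisfies the required linear
    conditions, two for [alpha < 1] and none otherwise, and there the form is nonnegative. *)
Lemma negative_dimension_le V n : linear_subspace V -> V `<=` W12 -> has_dimension V n ->
  negative_definite_on V (second_variation U gamma) ->
  (n <= if (1 <= alpha)%R then 0 else 2)%N.
Proof.
move=> VL VW [e [Ve eI _]] neg.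
rewrite leqNgt; apply/negP => nbig.
suff [c c0 cons] : exists2 c : 'I_n -> R, exists i, c i != 0 &
    (alpha < 1 -> radial_part (\sum_i c i *: e i) pi - radial_part (\sum_i c i *: e i) 0 = 0 /\
     radial_part (\sum_i c i *: e i) (pi / 2 + pi) - radial_part (\sum_i c i *: e i) (pi / 2) = 0).
  have VX := subspace_sum c VL Ve.
  have X0 : \sum_i c i *: e i <> 0.
    by move=> /eI cz; case: c0 => i; rewrite cz eqxx.
  have := neg _ VX X0; rewrite ltNge second_variation_ge0//.
  exact: VW.
have [a1|a1] := leP 1 alpha.
  rewrite a1 in nbig.
  exists (fun=> 1); last by [].
  by exists (Ordinal nbig); rewrite oner_neq0.
rewrite leNgt a1/= in nbig.
(* Row [i] holds the two conditions on [e i]. The rank is at most [2 < n], so the left kernel has a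
   nonzero row, whose entries are the coefficients. *)
pose A : 'M[R]_(n, 2) := \matrix_(i, j) (if j == 0
   then radial_part (e i) pi - radial_part (e i) 0
   else radial_part (e i) (pi / 2 + pi) - radial_part (e i) (pi / 2)).
have kn0 : kermx A != 0.
  rewrite kermx_eq0 /row_free neq_ltn (leq_ltn_trans _ nbig)//.
  exact: rank_leq_col.
have [i [j kij]] : exists i j, kermx A i j != 0.
  apply: contrapT => H; move/eqP: kn0; apply; apply/matrixP => i j; rewrite [RHS]mxE.
  by apply/eqP; apply: contrapT => /negP k0; apply: H; exists i, j.
pose c j := kermx A i j.
have cA : row i (kermx A) *m A = 0 by rewrite -row_mul mulmx_ker row0.
exists c; first by exists j.
move=> _; rewrite !radial_part_sum -!sumrB; split.
- move/matrixP: cA => /(_ 0 0); rewrite [LHS]mxE [RHS]mxE => E; rewrite -[RHS]E.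
  apply: eq_bigr => k _.
  by rewrite [X in _ = X * _]mxE [X in _ = _ * X]mxE /= -mulrBr.
- move/matrixP: cA => /(_ 0 1); rewrite [LHS]mxE [RHS]mxE => E; rewrite -[RHS]E.
  apply: eq_bigr => k _.
  by rewrite [X in _ = X * _]mxE [X in _ = _ * X]mxE /= -mulrBr.
Qed.

(* The combination with coefficients k0, k1 has u = k0 cos + k1 sin and
v = - 2 (k0 sin - k1 cos), so that v' + 2 w u = 0. *)
Definition neg_loop (i : 'I_2) : loop := fun t =>
  let C := cos (w * t + th) in let S := sin (w * t + th) in
  \row_j (if i == 0 then (if j == 0 then 1 + S ^+ 2 else - (C * S))
          else (if j == 0 then - (C * S) else 1 + C ^+ 2)).

Definition neg_space : set loop := [set x | exists c : 'I_2 -> R, x = \sum_i c i *: neg_loop i].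

Section NegativeLoop.
Variables (k0 k1 : R).
Definition neg_p t := k0 * (1 + sin (w * t + th) ^+ 2) - k1 * (cos (w * t + th) * sin (w * t + th)).
Definition neg_q t := - k0 * (cos (w * t + th) * sin (w * t + th)) + k1 * (1 + cos (w * t + th) ^+ 2).
Definition neg_p' t := w * (k0 * (2 * cos (w * t + th) * sin (w * t + th)) + k1 * (sin (w * t + th) ^+ 2 - cos (w * t + th) ^+ 2)).
Definition neg_q' t := w * (k0 * (sin (w * t + th) ^+ 2 - cos (w * t + th) ^+ 2) - k1 * (2 * cos (w * t + th) * sin (w * t + th))).

Lemma neg_p_derive t : is_derive t 1 neg_p (neg_p' t).
Proof. by rewrite /neg_p /neg_p'; derive_fun; ring. Qed.

Lemma neg_q_derive t : is_derive t 1 neg_q (neg_q' t).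
Proof. by rewrite /neg_q /neg_q'; derive_fun; ring. Qed.

Lemma neg_p'_continuous : continuous neg_p'. Proof. by rewrite /neg_p'; continuous_fun. Qed.
Lemma neg_q'_continuous : continuous neg_q'. Proof. by rewrite /neg_q'; continuous_fun. Qed.

Lemma neg_p_periodic : periodic neg_p (2 * pi).
Proof. by move=> t; rewrite /neg_p (cos_phase_periodic th w2) (sin_phase_periodic th w2). Qed.

Lemma neg_q_periodic : periodic neg_q (2 * pi).
Proof. by move=> t; rewrite /neg_q (cos_phase_periodic th w2) (sin_phase_periodic th w2). Qed.

Lemma neg_index_form : inner neg_p' neg_p' + inner neg_q' neg_q' +
    Int 0 (2 * pi) (hessian_density alpha w th neg_p neg_q) = (alpha - 1) * pi * (k0 ^+ 2 + k1 ^+ 2).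
Proof.
have cp' := neg_p'_continuous; have cq' := neg_q'_continuous.
have cH : continuous (hessian_density alpha w th neg_p neg_q).
  by apply: hessian_density_continuous; [exact: derive_continuous neg_p_derive|exact: derive_continuous neg_q_derive].
rewrite !inner_Int -!IntD; [|continuous_fun..].
pose N := k0 ^+ 2 + k1 ^+ 2.
(* An explicit primitive of the integrand: the part with factor [alpha + 5] is periodic, so only the
   linear term contributes over a period. *)
pose P t := (alpha + 5) * (w / 2 * (k0 ^+ 2 - k1 ^+ 2) * (sin (w * t + th) * cos (w * t + th))
   - w * k0 * k1 * cos (w * t + th) ^+ 2) + (alpha - 1) / 2 * N * t.
pose P' t := (alpha + 5) * (w ^+ 2 / 2 * (k0 ^+ 2 - k1 ^+ 2) * (cos (w * t + th) ^+ 2 - sin (w * t + th) ^+ 2)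
   + 2 * w ^+ 2 * k0 * k1 * (cos (w * t + th) * sin (w * t + th))) + (alpha - 1) / 2 * N.
have dP t : is_derive t 1 P (P' t) by rewrite /P /P'; derive_fun; field.
have cP' : continuous P' by rewrite /P'; continuous_fun.
have -> : Int 0 (2 * pi) (fun t => neg_p' t * neg_p' t + neg_q' t * neg_q' t +
    hessian_density alpha w th neg_p neg_q t) = Int 0 (2 * pi) P'.
  apply: eq_Rintegral => t _.
  rewrite /P' /hessian_density /radial /neg_p /neg_q /neg_p' /neg_q' /N; have := cos2Dsin2 (w * t + th).
  set C := cos _; set S := sin _ => CS.
  have {}CS : C ^+ 2 = 1 - S ^+ 2 by lra.
  by field: CS w2.
rewrite (Int_FTC dP cP' le0_2pi) /P.
have cE := cos_phase_periodic th w2 0; have sE := sin_phase_periodic th w2 0.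
rewrite add0r in cE; rewrite add0r in sE.
by rewrite cE sE /N; field.
Qed.

End NegativeLoop.

Lemma neg_loopE (c : 'I_2 -> R) t :
  (\sum_i c i *: neg_loop i) t 0 0 = neg_p (c 0) (c 1) t /\
  (\sum_i c i *: neg_loop i) t 0 1 = neg_q (c 0) (c 1) t.
Proof.
rewrite fct_sumE !summxE !big_ord_recl !big_ord0.
have -> : lift ord0 ord0 = 1 :> 'I_2 by exact: val_inj.
by rewrite /neg_p /neg_q !mxE /=; split; ring.
Qed.

Lemma neg_space_W12 : neg_space `<=` W12.
Proof.
move=> _ [c ->]; set x := \sum_i _.
have x0 t : x t 0 0 = neg_p (c 0) (c 1) t by exact: (neg_loopE c t).1.
have x1 t : x t 0 1 = neg_q (c 0) (c 1) t by exact: (neg_loopE c t).2.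
have E0 : (fun t => x t 0 0) = neg_p (c 0) (c 1) by apply/funext.
have E1 : (fun t => x t 0 1) = neg_q (c 0) (c 1) by apply/funext.
split.
- move=> t; apply/rowP => j; rewrite -(mulr_natl pi 2).
  case: (ord2E j) => ->; rewrite ?x0 ?x1; [exact: neg_p_periodic|exact: neg_q_periodic].
- move=> t; apply: differentiable_continuous; apply/derivable1_diffP; apply/derivable_mxP => i j.
  rewrite (ord1 i); case: (ord2E j) => ->; rewrite ?E0 ?E1.
    by case: (neg_p_derive (c 0) (c 1) t).
  by case: (neg_q_derive (c 0) (c 1) t).
- exists (fun t => \row_j (if j == 0 then neg_p' (c 0) (c 1) t else neg_q' (c 0) (c 1) t)).
  apply/L2_weak_derivativeP => i; case: (ord2E i) => ->; rewrite ?E0 ?E1.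
  + under eq_fun do rewrite mxE /=; split.
      exact: L2_continuous (@neg_p'_continuous _ _).
    exact: weak_der_C1 (@neg_p_derive _ _) (@neg_p'_continuous _ _) (@neg_p_periodic _ _).
  + under eq_fun do rewrite mxE /=; split.
      exact: L2_continuous (@neg_q'_continuous _ _).
    exact: weak_der_C1 (@neg_q_derive _ _) (@neg_q'_continuous _ _) (@neg_q_periodic _ _).
Qed.

Lemma neg_space_linear : linear_subspace neg_space.
Proof.
split; first by exists (fun=> 0); rewrite big1// => i _; rewrite scale0r.
move=> k _ _ [c ->] [d ->]; exists (fun i => k * c i + d i).
by rewrite scaler_sumr -big_split/=; apply: eq_bigr => i _; rewrite scalerDl scalerA.
Qed.

Lemma neg_space_dimension : has_dimension neg_space 2.
Proof.
exists neg_loop; split => //.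
- move=> i; exists (fun j => (j == i)%:R).
  rewrite (bigD1 i)//= eqxx scale1r big1 ?addr0// => j /negbTE ->.
  by rewrite scale0r.
- move=> c c0.
  (* At phase zero the two components of the combination are [c 0] and [2 * c 1]. *)
  have ph : w * (- th * w) + th = 0.
    by rewrite (_ : w * (- th * w) + th = th * (1 - w ^+ 2)); [rewrite w2; ring|ring].
  have [] := neg_loopE c (- th * w); rewrite c0 !mxE /neg_p /neg_q ph cos0 sin0 => z0 z1.
  by move=> i; case: (ord2E i) => ->; lra.
Qed.

Lemma neg_space_negative : alpha < 1 ->
  negative_definite_on neg_space (second_variation U gamma).
Proof.
move=> a1 xi Vxi xi0; have := Vxi => -[c xiE].
have x0 : coord_fun xi 0 = neg_p (c 0) (c 1).
  by apply/funext => t; rewrite xiE /coord_fun (neg_loopE c t).1.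
have x1 : coord_fun xi 1 = neg_q (c 0) (c 1).
  by apply/funext => t; rewrite xiE /coord_fun (neg_loopE c t).2.
have [cc0 p0] := W12_coord 0 (neg_space_W12 Vxi).
have [cc1 p1] := W12_coord 1 (neg_space_W12 Vxi).
have L0 := L2_continuous (@neg_p'_continuous (c 0) (c 1)).
have L1 := L2_continuous (@neg_q'_continuous (c 0) (c 1)).
have W0 := weak_der_C1 (@neg_p_derive (c 0) (c 1)) (@neg_p'_continuous _ _) (@neg_p_periodic _ _).
have W1 := weak_der_C1 (@neg_q_derive (c 0) (c 1)) (@neg_q'_continuous _ _) (@neg_q_periodic _ _).
rewrite -x0 in W0; rewrite -x1 in W1.
rewrite (second_variationE mass0 alpha0 a0 w2 radius gammaE cc0 cc1 L0 L1 W0 W1).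
rewrite -/(coord_fun xi 0) -/(coord_fun xi 1) x0 x1 neg_index_form.
have N0 : 0 < c 0 ^+ 2 + c 1 ^+ 2.
  rewrite lt_neqAle addr_ge0 ?sqr_ge0// andbT eq_sym paddr_eq0 ?sqr_ge0// !sqrf_eq0.
  apply/negP => /andP[/eqP c0 /eqP c1]; apply: xi0; rewrite xiE big1// => i _.
  by case: (ord2E i) => ->; rewrite ?c0 ?c1 scale0r.
have pi0 : 0 < pi :> R := pi_gt0 R.
by rewrite -mulrA pmulr_llt0 ?mulr_gt0// subr_lt0.
Qed.

Lemma morse_index_circular :
  morse_index U gamma = (if 1 <= alpha then 0%:E else 2%:E).
Proof.
apply/eqP; rewrite eq_le; apply/andP; split.
  apply: ge_ereal_sup => _ [n [V [VL VW dV neg]] <-].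
  have := negative_dimension_le VL VW dV neg.
  case: ifP => _ nle; rewrite lee_fin.
    by move: nle; rewrite leqn0 => /eqP ->.
  by rewrite ler_nat.
apply: ereal_sup_ubound; have [a1|a1] := leP 1 alpha.
  (* The zero space is needed as a witness: the supremum of an empty set of dimensions would be
     minus infinity. *)
  exists 0%N => //; exists [set 0]; split.
  - by split => // k x y -> ->; rewrite /= scaler0 addr0.
  - move=> _ ->; have := neg_space_W12 neg_space_linear.1; exact.
  - exists (fun=> 0); split => //.
      by move=> c _ [].
    by move=> _ ->; exists (fun=> 0); rewrite big_ord0.
  - by move=> xi ->.
exists 2%N => //; exists neg_space; split.
- exact: neg_space_linear.
- exact: neg_space_W12.
- exact: neg_space_dimension.
- exact: neg_space_negative.
Qed.

End MorseIndex.

Unset Implicit Arguments.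

Theorem mainTheorem1 (R : realType) (mu alpha : R) (gamma : R -> 'rV[R]_2)
    (mu_gt0 : 0 < mu) (alpha_bounds : 0 <= alpha < 2)
    (gamma_circ : circular_solution (kepler_potential mu alpha) gamma) :
  morse_index (kepler_potential mu alpha) gamma =
    (if 1 <= alpha then 0%:E else 2%:E).
Proof.
have [[a [w [th [a0 wabs gammaE]]]] sol] := gamma_circ.
have /andP[alpha0 _] := alpha_bounds.
have w2 : w ^+ 2 = 1 by rewrite -real_normK ?num_real// wabs expr1n.
have radius := equation_of_motion_radius a0 w2 gammaE sol.
exact: (morse_index_circular mu_gt0 alpha0 a0 w2 radius gammaE).
Qed.
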